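(* Assume the Continuum Hypothesis. Let $n$ be a positive integer and let $d_1,d_2$ be real numbers with $0<d_1\leq d_2<n$. Then the measure spaces $\left(\mathbb{R}^n,\mathcal{B}^{\sigma f}_{d_1},\mathcal{H}^{d_1}\right)$ and $\left(\mathbb{R}^n,\mathcal{B}^{\sigma f}_{d_2},\mathcal{H}^{d_2}\right)$ are isomorphic.
   Context: $\mathcal{H}^d$ denotes $d$-dimensional Hausdorff measure on $\mathbb{R}^n$. $\mathcal{B}^{\sigma f}_d$ denotes the $\sigma$-algebra of those Borel subsets $B$ of $\mathbb{R}^n$ such that $B$ or $\mathbb{R}^n\setminus B$ is of $\sigma$-finite $\mathcal{H}^d$-measure (a set is of $\sigma$-finite $\mathcal{H}^d$-measure if it can be covered by countably many sets of finite $\mathcal{H}^d$-measure). An isomorphism of two measure spaces $(X,\mathcal{S},\mu)$ and $(Y,\mathcal{T},\nu)$ is a bijection $f:X\to Y$ such that both $f$ and $f^{-1}$ are measurable-set preserving and measure preserving; that is, $f(S)\in\mathcal{T}$ and $\nu(f(S))=\mu(S)$ for every $S\in\mathcal{S}$, and $f^{-1}(T)\in\mathcal{S}$ and $\mu(f^{-1}(T))=\nu(T)$ for every $T\in\mathcal{T}$. Two measure spaces are isomorphic if there is an isomorphism between them. *)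

(* Defs.v *)
From HB Require Import structures.
From mathcomp Require Import all_boot all_order all_algebra.
From mathcomp Require Import all_classical all_reals all_analysis.

Set Implicit Arguments.
Unset Strict Implicit.
Unset Printing Implicit Defensive.
Import Order.TTheory GRing.Theory Num.Theory.
Import numFieldNormedType.Exports.

Local Open Scope classical_set_scope.
Local Open Scope ring_scope.
Local Open Scope ereal_scope.

Definition continuum_hypothesis (R : realType) : Prop :=
  forall A : set R, countable A \/ (A #= [set: R])%card.

(* The norm of the library on ['rV[R]_n] is the sup norm, hence the explicit
   Euclidean distance here. *)
Definition euclidean_dist (R : realType) (n : nat) (x y : 'rV[R]_n) : R :=
  Num.sqrt (\sum_(i < n) (x ord0 i - y ord0 i) ^+ 2)%R.

(* Adding 0 makes the diameter of the empty set 0 instead of -oo. *)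
Definition diameter (R : realType) (n : nat) (A : set 'rV[R]_n) : \bar R :=
  ereal_sup (0 |` [set (euclidean_dist x y)%:E | x in A & y in A]).

(* The d-th power of the diameter; the empty set contributes 0 even if d = 0. *)
Definition hausdorff_gauge (R : realType) (n : nat) (d : R)
    (A : set 'rV[R]_n) : \bar R :=
  if A == set0 then 0 else poweR (diameter A) d.

Definition delta_cover (R : realType) (n : nat) (delta : R)
    (A : set 'rV[R]_n) : set ((set 'rV[R]_n)^nat) :=
  [set U | A `<=` \bigcup_k U k /\ forall k, diameter (U k) <= delta%:E].

Definition hausdorff_delta (R : realType) (n : nat) (d delta : R)
    (A : set 'rV[R]_n) : \bar R :=
  ereal_inf [set \sum_(k <oo) hausdorff_gauge d (U k) |
             U in delta_cover delta A].

(* No normalizing constant. *)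
Definition hausdorff (R : realType) (n : nat) (d : R)
    (A : set 'rV[R]_n) : \bar R :=
  ereal_sup [set hausdorff_delta d delta A | delta in [set e : R | (0 < e)%R]].

Definition hausdorff_sigma_finite (R : realType) (n : nat) (d : R)
    (A : set 'rV[R]_n) : Prop :=
  exists2 F : (set 'rV[R]_n)^nat,
    A `<=` \bigcup_k F k & forall k, hausdorff d (F k) < +oo.

Definition borel_sigma_finite (R : realType) (n : nat) (d : R) :
    set (set 'rV[R]_n) :=
  [set B | <<s open >> B /\
    (hausdorff_sigma_finite d B \/ hausdorff_sigma_finite d (~` B))].

Section outer_measure.
Context (R : realType) (n : nat).
Implicit Types (d e : R) (A B : set 'rV[R]_n).

Lemma diameter_ge0 A : 0 <= diameter A.
Proof. by apply: ereal_sup_ubound; left. Qed.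

Lemma diameter0 : diameter (@set0 'rV[R]_n) = 0.
Proof.
apply/eqP; rewrite eq_le diameter_ge0 andbT.
by apply: ge_ereal_sup => _ [->//|[x []]].
Qed.

Lemma dist_le_diameter A x y : A x -> A y ->
  (euclidean_dist x y)%:E <= diameter A.
Proof. by move=> Ax Ay; apply: ereal_sup_ubound; right; exists x => //; exists y. Qed.

Lemma hausdorff_gauge_ge0 d A : 0 <= hausdorff_gauge d A.
Proof. by rewrite /hausdorff_gauge; case: ifP => // _; exact: poweR_ge0. Qed.
Hint Resolve hausdorff_gauge_ge0 : core.

Lemma hausdorff_gauge0 d : hausdorff_gauge d (@set0 'rV[R]_n) = 0.
Proof. by rewrite /hausdorff_gauge eqxx. Qed.

Lemma hausdorff_delta_ge0 d e A : 0 <= hausdorff_delta d e A.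
Proof. by apply: le_ereal_inf_tmp => _ [U _ <-]; exact: nneseries_ge0. Qed.
Hint Resolve hausdorff_delta_ge0 : core.

Lemma le_hausdorff_delta d e :
  {homo @hausdorff_delta R n d e : A B / A `<=` B >-> A <= B}.
Proof.
move=> A B AB; apply: ereal_inf_le_tmp => _ [U [BU Ue] <-].
by exists U => //; split => //; exact: subset_trans BU.
Qed.

Lemma hausdorff_delta_anti d e1 e2 A : (e1 <= e2)%R ->
  hausdorff_delta d e2 A <= hausdorff_delta d e1 A.
Proof.
move=> e12; apply: ereal_inf_le_tmp => _ [U [AU Ue] <-].
by exists U => //; split => // k; rewrite (le_trans (Ue k))// lee_fin.
Qed.

Lemma hausdorff_delta0 d e : (0 < e)%R -> hausdorff_delta d e (@set0 'rV[R]_n) = 0.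
Proof.
move=> e0; apply/eqP; rewrite eq_le hausdorff_delta_ge0 andbT.
apply: ereal_inf_lbound; exists (fun=> set0).
  by split => // k; rewrite diameter0 lee_fin ltW.
by rewrite eseries0// => *; exact: hausdorff_gauge0.
Qed.

Lemma hausdorff_delta_sigma_subadditive d e :
  sigma_subadditive (@hausdorff_delta R n d e).
Proof.
move=> A; have [[i ioo]|] := pselect (exists i, hausdorff_delta d e (A i) = +oo).
  by rewrite (eseries_pinfty _ _ ioo) ?leey// => k _;
    rewrite -ltNye (lt_le_trans _ (hausdorff_delta_ge0 _ _ _)).
rewrite -forallNE => Aoo.
suff add2e (r : {posnum R}) : hausdorff_delta d e (\bigcup_k A k) <=
    \sum_(i <oo) hausdorff_delta d e (A i) + r%:num%:E.
  by apply/lee_addgt0Pr => _/posnumP[].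
rewrite (le_trans _ (epsilon_trick _ _ _))//.
pose P k (U : (set 'rV[R]_n)^nat) := delta_cover e (A k) U /\
  \sum_(i <oo) hausdorff_gauge d (U i) <=
    hausdorff_delta d e (A k) + (r%:num / (2 ^ k.+1)%:R)%:E.
have [G PG] : {G : ((set 'rV[R]_n)^nat)^nat & forall k, P k (G k)}.
  apply: (@choice _ _ P) => k.
  have rk : (0 < r%:num / (2 ^ k.+1)%:R)%R by [].
  have Afin : hausdorff_delta d e (A k) \is a fin_num.
    by rewrite ge0_fin_numE// ltey; exact/eqP/Aoo.
  have [_ [U AU <-] Uk] := lb_ereal_inf_adherent rk Afin.
  by exists U; split => //; exact: ltW.
apply: (@le_trans _ _
    (\esum_(i in setT) (hausdorff_gauge d \o uncurry G) i)).
  apply: ereal_inf_lbound => /=.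
  have /card_esym/ppcard_eqP[f] := card_nat2.
  exists (uncurry G \o f).
    split => [t [i _ /(PG i).1.1 [j _ Gij]]|k].
      by exists (f^-1%FUN (i, j)) => //=; rewrite invK ?inE.
    by rewrite /= /uncurry; case: (f k) => i j; exact: (PG i).1.2.
  rewrite -(esum_pred_image (hausdorff_gauge d \o uncurry G) _ xpredT) ?[fun=> _]set_true//.
    by rewrite image_eq.
  by move=> *; exact: hausdorff_gauge_ge0.
rewrite (_ : esum _ _ =
    \sum_(i <oo) \sum_(j <oo ) hausdorff_gauge d (G i j)); last first.
  pose J : nat -> set (nat * nat) := fun i => [set (i, j) | j in setT].
  rewrite (_ : setT = \bigcup_k J k); last first.
    by rewrite predeqE => -[a b]; split => // _; exists a => //; exists b.
  rewrite esum_bigcupT /=; last 2 first.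
    - apply/trivIsetP => i j _ _ ij.
      rewrite predeqE => -[k m] /=; split => //= -[] [_] _ [<-{k} _].
      by move=> [m' _] [] /esym/eqP; rewrite (negbTE ij).
    - by move=> [? ?]; exact: hausdorff_gauge_ge0.
  rewrite -(image_id [set: nat]) -fun_true esum_pred_image//; last first.
    by move=> k _; apply: esum_ge0 => *; exact: hausdorff_gauge_ge0.
  apply: eq_eseriesr => /= j _.
  rewrite -(esum_pred_image (hausdorff_gauge d \o uncurry G) (pair j) predT)//=.
  - by congr esum; rewrite predeqE => -[a b]; split; move=> [i _ <-]; exists i.
  - by move=> ? ? _ _; exact: (@can_inj _ _ _ snd).
apply: lee_nneseries.
- by move=> k _ _; exact: nneseries_ge0.
- by move=> k _; exact: (PG k).2.
Qed.

Lemma hausdorff_ge0 d A : 0 <= hausdorff d A.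
Proof.
apply: (@le_trans _ _ (hausdorff_delta d 1 A)) => //.
by apply: ereal_sup_ubound; exists 1%R => //=.
Qed.

Lemma hausdorff0 d : hausdorff d (@set0 'rV[R]_n) = 0.
Proof.
apply/eqP; rewrite eq_le hausdorff_ge0 andbT.
by apply: ge_ereal_sup => _ [e /= e0 <-]; rewrite hausdorff_delta0.
Qed.

Lemma le_hausdorff d : {homo @hausdorff R n d : A B / A `<=` B >-> A <= B}.
Proof.
move=> A B AB; apply: ge_ereal_sup => _ [e /= e0 <-].
apply: (le_trans (le_hausdorff_delta _ _ AB)).
by apply: ereal_sup_ubound; exists e.
Qed.

Lemma hausdorff_sigma_subadditive d : sigma_subadditive (@hausdorff R n d).
Proof.
move=> A; apply: ge_ereal_sup => _ [e /= e0 <-].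
apply: (le_trans (hausdorff_delta_sigma_subadditive _ _ _)).
apply: lee_nneseries => // k _.
by apply: ereal_sup_ubound; exists e.
Qed.

HB.instance Definition _ d := isOuterMeasure.Build R 'rV[R]_n (@hausdorff R n d)
  (hausdorff0 d) (hausdorff_ge0 d) (@le_hausdorff d)
  (hausdorff_sigma_subadditive d).

End outer_measure.

Section caratheodory_criterion.
Context (R : realType).

Lemma caratheodory_sublevel (T : Type) (mu : {outer_measure set T -> \bar R})
    (g : T -> \bar R) :
  (forall (s t : R) (A B : set T), (s < t)%R ->
    (forall x, A x -> g x <= s%:E) -> (forall x, B x -> t%:E <= g x) ->
    mu A + mu B <= mu (A `|` B)) ->
  mu.-caratheodory [set x | g x <= 0].
Proof.
move=> sep; apply: le_caratheodory_measurable => A.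
have [->|Aoo] := eqVneq (mu A) +oo; first by rewrite leey.
have mu0 := outer_measure_ge0 mu.
have Afin : mu A \is a fin_num by rewrite ge0_fin_numE// ltey.
pose t k : R := (k.+1%:R^-1)%R.
have t0 k : (0 < t k)%R by rewrite invr_gt0.
have t_lt k m : (k < m)%N -> (t m < t k)%R.
  by move=> km; rewrite ltf_pV2 ?posrE// ltr_nat.
have t_le k m : (k <= m)%N -> (t m <= t k)%R.
  by move=> km; rewrite lef_pV2 ?posrE// ler_nat.
pose P k := A `&` [set x | (t k.+2)%:E < g x /\ g x <= (t k.+1)%:E].
have PA s N : \sum_(0 <= k < N) mu (P (k.*2 + s)%N) <=
    mu (A `&` [set x | (t (N.*2 + s)%N)%:E < g x]).
  elim: N => [|N ih]; first by rewrite big_geq.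
  rewrite big_nat_recr//= (le_trans (leeD2r _ ih))// addeC.
  apply: le_trans (sep _ _ _ _ (t_lt _ _ (ltnSn (N.*2 + s))) _ _) _.
  - by move=> x [_ []].
  - by move=> x [_ /ltW].
  - apply: le_outer_measure => x [[Ax [gx _]]|[Ax gx]]; split=> //=.
    apply: le_lt_trans gx; rewrite lee_fin; apply: t_le.
    by rewrite leq_add2r leq_double.
have even_odd (a : nat -> \bar R) N : (forall k, 0 <= a k) ->
    \sum_(0 <= k < N.*2) a k =
    \sum_(0 <= k < N) a (k.*2 + 0)%N + \sum_(0 <= k < N) a (k.*2 + 1)%N.
  move=> a0; elim: N => [|N ih]; first by rewrite !big_geq// adde0.
  rewrite doubleS !big_nat_recr//= ih addn0 addn1.
  by rewrite -!addeA; congr (_ + _); rewrite addeCA.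
have sumP : \sum_(0 <= k <oo) mu (P k) < +oo.
  apply: (@le_lt_trans _ _ (mu A + mu A)); last first.
    by rewrite -ge0_fin_numE ?adde_ge0// fin_numD Afin.
  apply: lime_le; first exact: is_cvg_nneseries.
  apply: nearW => N; apply: (@le_trans _ _ (\sum_(0 <= k < N.*2) mu (P k))).
    apply: lee_sum_nneg_natr => //.
    by rewrite -addnn leq_addr.
  by rewrite even_odd// leeD// (le_trans (PA _ _))// le_outer_measure.
have tail0 := nneseries_tail_cvg sumP (fun k _ => mu0 (P k)).
have bound N : mu (A `&` [set x | g x <= 0]) +
    mu (A `&` ~` [set x | g x <= 0]) <= mu A + \sum_(N <= k <oo) mu (P k).
  apply: (@le_trans _ _ (mu (A `&` [set x | g x <= 0]) +
      (mu (A `&` [set x | (t N.+1)%:E < g x]) + \sum_(N <= k <oo) mu (P k)))).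
    rewrite leeD2l//.
    have := leeD2l (mu (A `&` [set x | (t N.+1)%:E < g x]))
      (outer_measure_sigma_subadditive_tail mu N P).
    apply: le_trans; apply: le_trans (outer_measureU2 _ _ _).
    apply: le_outer_measure => x [Ax /negP]; rewrite -ltNge => gx0.
    have [gN|gN] := ltP (t N.+1)%:E (g x); [by left|right].
    have ex_m : exists m, (t m)%:E < g x.
      have gfin : g x \is a fin_num.
        by rewrite ge0_fin_numE ?ltW// (le_lt_trans gN)// ltry.
      have fg0 : (0 < fine (g x))%R by rewrite fine_gt0// gx0 (le_lt_trans gN)// ltry.
      exists (Num.truncn (fine (g x))^-1%R).
      rewrite -(fineK gfin) lte_fin /t invf_plt ?posrE//.
      exact: truncnS_gt.
    have [m gm mmin] := ex_minnP ex_m.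
    have Nm : (N.+1 < m)%N.
      rewrite ltnNge; apply/negP => mN.
      by have := lt_le_trans gm gN; rewrite lte_fin ltNge t_le.
    case: m Nm gm mmin => [|[|m]]// Nm gm mmin.
    exists m; first by apply/negP; rewrite -leqNgt.
    by split => //; split => //; rewrite leNgt; apply/negP => /mmin; rewrite ltnn.
  rewrite addeA leeD2r//.
  apply: le_trans (sep _ _ _ _ (t0 N.+1) _ _) _.
  - by move=> x [].
  - by move=> x [_ /ltW].
  - by apply: le_outer_measure => x [] [].
rewrite -[leRHS]adde0.
have lim_bound : mu A + \sum_(N <= k <oo) mu (P k) @[N --> \oo] --> mu A + 0.
  exact: (cvgeD (fin_num_adde_defr _ Afin) (cvg_cst _) tail0).
rewrite -(cvg_lim _ lim_bound)//; apply: lime_ge.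
  exact: cvgP lim_bound.
by apply: nearW => N; exact: bound.
Qed.

End caratheodory_criterion.

Section borel_caratheodory.
Context (R : realType) (n : nat).
Implicit Types (d e : R) (A B C : set 'rV[R]_n).

Lemma edist_le_euclidean (x y : 'rV[R]_n) :
  edist (x, y) <= (euclidean_dist x y)%:E.
Proof.
apply/lee_addgt0Pr => r r0; rewrite -EFinD.
have d0 : (0 <= euclidean_dist x y)%R by exact: sqrtr_ge0.
have dr0 : (0 < euclidean_dist x y + r)%R by rewrite ltr_wpDl.
apply: edist_fin => //=; split => // i j.
rewrite ord1 -ball_normE /ball_/= (@le_lt_trans _ _ (euclidean_dist x y))//.
  rewrite -sqrtr_sqr ler_sqrt ?sumr_ge0// => [|k _]; last exact: sqr_ge0.
  by rewrite (bigD1 j)//= lerDl sumr_ge0// => k _; exact: sqr_ge0.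
by rewrite ltrDl.
Qed.

Lemma hausdorff_separated d e A B : (0 < e)%R ->
  (forall x y, A x -> B y -> (e <= euclidean_dist x y)%R) ->
  hausdorff d A + hausdorff d B <= hausdorff d (A `|` B).
Proof.
move=> e0 AB.
have sep r : (r < e)%R -> hausdorff_delta d r A + hausdorff_delta d r B <=
    hausdorff_delta d r (A `|` B).
  move=> re; apply: le_ereal_inf_tmp => _ [U [ABU Ur] <-].
  pose V C k := if C `&` U k == set0 then set0 else U k.
  have VU C k : C `<=` A `|` B -> delta_cover r C (V C).
    move=> CAB; split=> [x Cx|i]; last first.
      rewrite /V; case: ifP => // _.
      by rewrite diameter0 (le_trans (diameter_ge0 (U i))).
    have [i _ Ux] := ABU _ (CAB _ Cx); exists i => //.
    by rewrite /V; case: ifPn => // /eqP CU0; have : set0 x by rewrite -CU0.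
  have leV C : C `<=` A `|` B -> hausdorff_delta d r C <=
      \sum_(k <oo) hausdorff_gauge d (V C k).
    by move=> CAB; apply: ereal_inf_lbound; exists (V C) => //; exact: VU.
  apply: (le_trans (leeD (leV A _) (leV B _))); first exact: subsetUl.
    exact: subsetUr.
  have g0 := hausdorff_gauge_ge0.
  rewrite -nneseriesD//; apply: lee_nneseries => [k _ _|k _].
    exact: adde_ge0.
  rewrite /V; case: ifPn => [_|/set0P[x [Ax Ux]]].
    by rewrite hausdorff_gauge0 add0e; case: ifP => _; rewrite ?hausdorff_gauge0.
  case: ifPn => [_|/set0P[y [By Uy]]]; first by rewrite hausdorff_gauge0 adde0.
  have := le_trans (dist_le_diameter Ux Uy) (Ur k).
  by rewrite lee_fin leNgt (lt_le_trans re (AB _ _ Ax By)).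
have [->|ABoo] := eqVneq (hausdorff d (A `|` B)) +oo; first by rewrite leey.
have fin C : C `<=` A `|` B -> hausdorff d C \is a fin_num.
  move=> CAB; rewrite ge0_fin_numE ?hausdorff_ge0//.
  by rewrite (le_lt_trans (le_hausdorff d CAB))// ltey.
rewrite -leeBrDr ?fin//; apply: ge_ereal_sup => _ [r1 /= r10 <-].
have le_sup r C : (0 < r)%R -> hausdorff_delta d r C <= hausdorff d C.
  by move=> r0; apply: ereal_sup_ubound; exists r.
have finA : hausdorff_delta d r1 A \is a fin_num.
  rewrite ge0_fin_numE ?hausdorff_delta_ge0// (le_lt_trans (le_sup _ _ r10))//.
  by rewrite -ge0_fin_numE ?hausdorff_ge0// fin//; exact: subsetUl.
rewrite leeBrDr ?fin// addeC -leeBrDr//.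
apply: ge_ereal_sup => _ [r2 /= r20 <-]; rewrite leeBrDr// addeC.
pose r := Num.min (e / 2)%R (Num.min r1 r2).
have r0 : (0 < r)%R by rewrite !lt_min r10 r20 divr_gt0.
have re : (r < e)%R by rewrite gt_min ltr_pdivrMr// ltr_pMr// ltr1n.
apply: le_trans (le_sup r _ r0); apply: le_trans (sep r re).
by rewrite leeD// hausdorff_delta_anti// !ge_min lexx ?orbT.
Qed.

Lemma closed_caratheodory d C : closed C -> (hausdorff d).-caratheodory C.
Proof.
move=> Ccl; have -> : C = [set x | @edist_inf R _ C x <= 0].
  apply/seteqP; split=> x /=; first by move=> /edist_inf0 ->.
  move=> Cx0; apply: Ccl => B /nbhs_ballP[r /= r0 rB].
  have : @edist_inf R _ C x < r%:E by rewrite (le_lt_trans Cx0).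
  move=> /ereal_inf_lt[_ [y Cy <-]] /edist_lt_ball xy.
  by exists y; split => //; exact: rB.
apply: caratheodory_sublevel => s t A B st As Bt.
apply: (@hausdorff_separated d (t - s)%R); first by rewrite subr_gt0.
move=> x y Ax By; rewrite lerBlDr -lee_fin EFinD.
apply: (le_trans (Bt _ By)); apply: (le_trans (edist_inf_triangle _ _ x)).
by rewrite leeD// ?As// edist_sym edist_le_euclidean.
Qed.

Lemma borel_caratheodory d :
  <<s @open 'rV[R]_n >> `<=` (hausdorff d).-caratheodory.
Proof.
apply: smallest_sub.
  split; first exact: caratheodory_measurable_set0.
  - by move=> A mA; rewrite setTD; exact: caratheodory_measurable_setC.
  - by move=> A mA; exact: caratheodory_measurable_bigcup.
move=> A oA; rewrite -(setCK A); apply: caratheodory_measurable_setC.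
by apply: closed_caratheodory; exact: open_closedC.
Qed.

Lemma sub_hausdorff_sigma_finite d A B : A `<=` B ->
  hausdorff_sigma_finite d B -> hausdorff_sigma_finite d A.
Proof. by move=> AB [F BF Foo]; exists F => //; exact: subset_trans BF. Qed.

Lemma hausdorff_sigma_finite_bigcup d (A : (set 'rV[R]_n)^nat) :
  (forall k, hausdorff_sigma_finite d (A k)) ->
  hausdorff_sigma_finite d (\bigcup_k A k).
Proof.
move=> /(_ _)/cid2-/all_sig2[F AF Foo].
have /card_esym/ppcard_eqP[f] := card_nat2.
exists (fun k => F (f k).1 (f k).2) => // x [i _ /AF[j _ Fx]].
by exists (f^-1%FUN (i, j)) => //=; rewrite invK ?inE.
Qed.

Lemma borel_sigma_finite0 d : borel_sigma_finite d (@set0 'rV[R]_n).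
Proof.
split; first exact: sigma_algebra0.
by left; exists (fun=> set0) => // k; rewrite hausdorff0.
Qed.

Lemma borel_sigma_finiteC d A :
  borel_sigma_finite d A -> borel_sigma_finite d (~` A).
Proof.
move=> [mA sA]; split; first exact: sigma_algebraC.
by rewrite setCK; case: sA; [right|left].
Qed.

Lemma borel_sigma_finite_bigcup d (A : (set 'rV[R]_n)^nat) :
  (forall k, borel_sigma_finite d (A k)) ->
  borel_sigma_finite d (\bigcup_k A k).
Proof.
move=> mA; split; first by apply: sigma_algebra_bigcup => k; case: (mA k).
have [sA|] := pselect (forall k, hausdorff_sigma_finite d (A k)).
  by left; exact: hausdorff_sigma_finite_bigcup.
move=> /existsNP[k kA]; right; have [_ []// sA] := mA k.
by apply: sub_hausdorff_sigma_finite sA; apply: subsetC; exact: bigcup_sup.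
Qed.

End borel_caratheodory.

(* A copy of [R ^ n] with the sigma-algebra [borel_sigma_finite d]. *)
Definition borel_sf_type (R : realType) (n : nat) (d : R) : Type := 'rV[R]_n.

Definition borel_sf_display (R : realType) (n : nat) (d : R) : measure_display.
Proof. exact. Qed.

Section hausdorff_measure.
Context (R : realType) (n : nat) (d : R).

HB.instance Definition _ := Pointed.on (borel_sf_type n d).
HB.instance Definition _ := @isMeasurable.Build (borel_sf_display n d)
  (borel_sf_type n d) (@borel_sigma_finite R n d)
  (@borel_sigma_finite0 R n d) (@borel_sigma_finiteC R n d)
  (@borel_sigma_finite_bigcup R n d).

Definition hausdorff_measure : set (borel_sf_type n d) -> \bar R := hausdorff d.

Let hausdorff_measure0 : hausdorff_measure set0 = 0.
Proof. exact: hausdorff0. Qed.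

Let hausdorff_measure_ge0 A : 0 <= hausdorff_measure A.
Proof. exact: hausdorff_ge0. Qed.

Let hausdorff_measure_sigma_additive : semi_sigma_additive hausdorff_measure.
Proof.
move=> A mA tA _.
have cA k : (hausdorff d).-caratheodory (A k).
  by apply: borel_caratheodory; case: (mA k).
apply: (@caratheodory_measure_sigma_additive _ _ (hausdorff d)) => //.
exact: caratheodory_measurable_bigcup.
Qed.

HB.instance Definition _ := isMeasure.Build _ _ _ hausdorff_measure
  hausdorff_measure0 hausdorff_measure_ge0 hausdorff_measure_sigma_additive.

End hausdorff_measure.
Arguments hausdorff_measure {R} n d.

Definition measure_isomorphism (R : realType) (dX dY : measure_display)
    (X : measurableType dX) (Y : measurableType dY)
    (mu : {measure set X -> \bar R}) (nu : {measure set Y -> \bar R})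
    (f : X -> Y) : Prop :=
  [/\ bijective f,
      forall S, measurable S -> measurable (f @` S) /\ nu (f @` S) = mu S &
      forall T, measurable T -> measurable (f @^-1` T) /\ mu (f @^-1` T) = nu T].

Definition measure_isomorphic (R : realType) (dX dY : measure_display)
    (X : measurableType dX) (Y : measurableType dY)
    (mu : {measure set X -> \bar R}) (nu : {measure set Y -> \bar R}) : Prop :=
  exists f : X -> Y, measure_isomorphism mu nu f.

(* Main.v *)
Require Import Defs.
From HB Require Import structures.
From mathcomp Require Import all_boot all_order all_algebra.
From mathcomp Require Import all_classical all_reals all_analysis.
From mathcomp Require Import measurable_realfun wochoice.
From mathcomp Require Import ring lra zify.
Import Order.TTheory GRing.Theory Num.Theory.
Import numFieldNormedType.Exports.
Local Open Scope classical_set_scope.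
Local Open Scope ring_scope.
Set Implicit Arguments.
Unset Strict Implicit.
Unset Printing Implicit Defensive.

(* By CH, well-order the continuum in type omega_1. Every set of sigma-finite
   H^d measure lies in a G_delta-type set of sigma-finite measure, and those are
   coded by sequences of bits, so R^n splits into omega_1 disjoint Borel pieces
   of sigma-finite measure such that countably many of them cover any given set
   of sigma-finite measure. Adding Cantor sets makes every piece of infinite
   measure. Each piece is then isomorphic to one and the same model, the real
   line with Lebesgue measure on [0, +oo[ (and a null copy of the line on the
   left), by a measure-preserving Schroeder-Bernstein argument; matching the
   pieces for d1 with those for d2 and gluing gives the isomorphism. *)

(** * Borel embeddings and isomorphisms of measures *)

(** The obstacle is that a union of uncountably many Borel sets need not be Borel, so a map glued
    from the pieces cannot be expected to preserve all Borel sets. It does preserve those of the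
    theorem: a sigma-finite set is cut by the partition into countably many Borel parts, and a
    co-sigma-finite set contains a whole piece, so it has infinite measure on both sides. Infinite
    measure is imposed on the pieces because pieces of equal index must have equal total measure.
    The added sets must be almost disjoint from everything used before; that is why a continuum of
    disjoint Cantor sets is needed, and [d < n] is what makes room for them. Within a piece, the
    cumulative distribution function gives an isomorphism only up to null sets, and the null sets
    left over on the two sides may be of different sizes. Hence the model carries a null line that
    can absorb any null Borel set, and every co-null part of the model contains a null copy of the
    line; this gives embeddings both ways. *)

Section embedding.
Context d1 d2 (T1 : measurableType d1) (T2 : measurableType d2) (R : realType).

(** Borel images are demanded here instead of being derived from injectivity by the Lusin-Souslin
    theorem; every map built below has an explicit Borel left inverse. *)
Definition borel_embedding (A : set T1) (B : set T2) (f : T1 -> T2) : Prop :=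
  [/\ {in A &, injective f}, f @` A `<=` B,
      forall S, measurable S -> S `<=` A -> measurable (f @` S) &
      forall S, measurable S -> measurable (A `&` f @^-1` S)].

Definition measure_embedding (mu1 : set T1 -> \bar R) (mu2 : set T2 -> \bar R)
    (A : set T1) (B : set T2) (f : T1 -> T2) : Prop :=
  borel_embedding A B f /\
  forall S, measurable S -> S `<=` A -> mu2 (f @` S) = mu1 S.

Lemma borel_embedding_sub A A' B B' f : measurable A' -> A' `<=` A ->
  f @` A' `<=` B' -> borel_embedding A B f -> borel_embedding A' B' f.
Proof.
move=> mA' AA' fB' [inj _ im pre]; split=> //.
- by move=> x y; rewrite !inE => /AA' Ax /AA' Ay; apply: inj; rewrite inE.
- by move=> S mS SA'; apply: im => //; exact: subset_trans AA'.
- move=> S mS; have -> : A' `&` f @^-1` S = A' `&` (A `&` f @^-1` S).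
    by rewrite setIA (setIidl AA').
  by apply: measurableI => //; exact: pre.
Qed.

Lemma measure_embedding_sub mu1 mu2 A A' B B' f : measurable A' -> A' `<=` A ->
  f @` A' `<=` B' -> measure_embedding mu1 mu2 A B f ->
  measure_embedding mu1 mu2 A' B' f.
Proof.
move=> mA' AA' fB' [bf mf]; split; first exact: borel_embedding_sub bf.
by move=> S mS SA'; apply: mf => //; exact: subset_trans AA'.
Qed.

Lemma measure_embedding_codomain mu1 mu2 A B B' f : B `<=` B' ->
  measure_embedding mu1 mu2 A B f -> measure_embedding mu1 mu2 A B' f.
Proof.
move=> BB' [[inj fAB im pre] mf]; split=> //; split=> //.
exact: subset_trans BB'.
Qed.

Lemma borel_embedding_measurable A B f : measurable A ->
  borel_embedding A B f -> measurable (f @` A).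
Proof. by move=> mA [_ _ + _]; exact. Qed.

Lemma null_embedding (mu1 : {measure set T1 -> \bar R})
    (mu2 : {measure set T2 -> \bar R}) A B f :
  measurable A -> measurable B -> mu1 A = 0%E -> mu2 B = 0%E ->
  borel_embedding A B f -> measure_embedding mu1 mu2 A B f.
Proof.
move=> mA mB A0 B0 bf; split=> // S mS SA; have [_ fAB im _] := bf.
rewrite (subset_measure0 mS mA SA A0).
apply: (subset_measure0 _ mB) => //; first exact: im.
by apply: subset_trans fAB; exact: image_subset.
Qed.

Lemma borel_embedding_glue A1 A2 B1 B2 f1 f2 :
  measurable A1 -> measurable A2 -> A1 `&` A2 = set0 -> B1 `&` B2 = set0 ->
  borel_embedding A1 B1 f1 -> borel_embedding A2 B2 f2 ->
  borel_embedding (A1 `|` A2) (B1 `|` B2)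
    (fun x => if x \in A1 then f1 x else f2 x).
Proof.
move=> mA1 mA2 A12 B12 [i1 s1 m1 p1] [i2 s2 m2 p2].
have nA2 x : A2 x -> x \in A1 = false.
  move=> A2x; apply/negbTE; rewrite notin_setE => A1x.
  by have : set0 x by rewrite -A12.
have B12F x y : A1 x -> A2 y -> f1 x = f2 y -> False.
  move=> A1x A2y e; suff : set0 (f1 x) by [].
  by rewrite -B12; split; [apply: s1; exists x|rewrite e; apply: s2; exists y].
have imE S : S `<=` A1 `|` A2 -> (fun x => if x \in A1 then f1 x else f2 x) @` S
    = f1 @` (S `&` A1) `|` f2 @` (S `&` A2).
  move=> SA; apply/seteqP; split => [_ [x Sx <-]|y [] [x [Sx Ax] <-]].
  - have [A1x|A2x] := SA _ Sx.
      by rewrite (mem_set A1x); left; exists x.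
    by rewrite nA2//; right; exists x.
  - by exists x => //; rewrite mem_set.
  - by exists x => //; rewrite nA2.
split.
- move=> x y; rewrite !inE => -[Ax|Ax] [Ay|Ay];
    rewrite ?(mem_set Ax) ?(mem_set Ay) ?(nA2 _ Ax) ?(nA2 _ Ay).
  + by apply: i1; rewrite inE.
  + by move=> /B12F; case.
  + by move=> /esym /B12F; case.
  + by apply: i2; rewrite inE.
- rewrite imE// => y [] [x [_ Ax] <-].
  + by left; apply: s1; exists x.
  + by right; apply: s2; exists x.
- by move=> S mS SA; rewrite imE//; apply: measurableU;
    [apply: m1 => //; exact: measurableI|apply: m2 => //; exact: measurableI].
- move=> S mS.
  rewrite (_ : _ `&` _ = (A1 `&` f1 @^-1` S) `|` (A2 `&` f2 @^-1` S)).
    by apply: measurableU; [exact: p1|exact: p2].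
  apply/seteqP; split=> x /=.
    by move=> [[Ax|Ax]]; rewrite ?(mem_set Ax) ?nA2// => Sx; [left|right].
  by move=> [|] [Ax Sx]; rewrite ?(mem_set Ax) ?nA2//; split=> //; [left|right].
Qed.

Lemma measure_embedding_glue (mu1 : {measure set T1 -> \bar R})
    (mu2 : {measure set T2 -> \bar R}) A1 A2 B1 B2 f1 f2 :
  measurable A1 -> measurable A2 -> A1 `&` A2 = set0 -> B1 `&` B2 = set0 ->
  measure_embedding mu1 mu2 A1 B1 f1 -> measure_embedding mu1 mu2 A2 B2 f2 ->
  measure_embedding mu1 mu2 (A1 `|` A2) (B1 `|` B2)
    (fun x => if x \in A1 then f1 x else f2 x).
Proof.
move=> mA1 mA2 A12 B12 [b1 e1] [b2 e2]; split; first exact: borel_embedding_glue.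
move=> S mS SA.
have A12S : (S `&` A1) `&` (S `&` A2) = set0.
  by rewrite setIACA A12 setI0.
have [i1 s1 m1 _] := b1; have [i2 s2 m2 _] := b2.
have mS1 : measurable (S `&` A1) by exact: measurableI.
have mS2 : measurable (S `&` A2) by exact: measurableI.
have ES : S = (S `&` A1) `|` (S `&` A2) by rewrite -setIUr; apply/esym/setIidl.
have e1S : mu2 (f1 @` (S `&` A1)) = mu1 (S `&` A1) by exact: e1.
have e2S : mu2 (f2 @` (S `&` A2)) = mu1 (S `&` A2) by exact: e2.
have -> : mu1 S = (mu1 (S `&` A1) + mu1 (S `&` A2))%E.
  by rewrite [in LHS]ES measureU.
rewrite -e1S -e2S -measureU//; last first.
- apply/seteqP; split=> // y [[x [_ Ax] <-] [x' [_ Ax'] e]].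
  suff : set0 (f1 x) by [].
  by rewrite -B12; split; [apply: s1; exists x|rewrite -e; apply: s2; exists x'].
- exact: m2.
- exact: m1.
congr (mu2 _); rewrite [in LHS]ES image_setU; congr (_ `|` _).
  by apply: eq_imagel => x [_ Ax]; rewrite mem_set.
apply: eq_imagel => x [_ Ax]; case: ifPn => //; rewrite inE => A1x.
by have : set0 x by rewrite -A12.
Qed.

End embedding.

Section isomorphism.
Context d1 d2 (T1 : measurableType d1) (T2 : measurableType d2) (R : realType).
Variables (mu1 : {measure set T1 -> \bar R}) (mu2 : {measure set T2 -> \bar R}).

(** The image of [S] is the set of [y] with [g y] in [S] and [f (g y) = y]. The injection [h] into
    the reals turns this last equation into an equality of real measurable functions. *)
Lemma borel_embedding_left_inverse (A : set T1) (B : set T2) (f : T1 -> T2)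
    (g : T2 -> T1) (h : T2 -> R) : measurable A ->
  measurable_fun setT f -> measurable_fun setT g -> f @` A `<=` B ->
  {in A, cancel f g} -> measurable_fun setT h -> injective h ->
  borel_embedding A B f.
Proof.
move=> mA mf mg fAB fK mh ih; split=> //.
- by move=> x y Ax Ay /(congr1 g); rewrite !fK.
- move=> S mS SA.
  have -> : f @` S = g @^-1` S `&` [set y | h (f (g y)) == h y].
    apply/seteqP; split=> [_ [x Sx <-]|y [/= Sgy /eqP/ih fgy]].
      by rewrite /= fK ?inE//; exact: SA.
    by exists (g y).
  apply: measurableI; first by rewrite -[_ @^-1` _]setTI; exact: mg.
  rewrite -[[set _ | _]]setTI.
  have : measurable_fun setT (fun y => h (f (g y)) == h y).
    apply: measurable_fun_eqr => //.
    by apply: (measurableT_comp mh); exact: (measurableT_comp mf).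
  by move=> /(_ measurableT [set true]); exact.
- by move=> S mS; apply: measurableI => //; rewrite -[_ @^-1` _]setTI; exact: mf.
Qed.

Definition measure_iso (A : set T1) (B : set T2) (f : T1 -> T2) : Prop :=
  measure_embedding mu1 mu2 A B f /\ f @` A = B.

Lemma measure_embedding_iso A B f :
  measure_embedding mu1 mu2 A B f -> measure_iso A (f @` A) f.
Proof. by move=> [[inj _ im pre] mf]; split=> //; split=> //; split. Qed.

Lemma eq_measure_iso A B f g : (forall x, A x -> f x = g x) ->
  measure_iso A B f -> measure_iso A B g.
Proof.
move=> fg [[[inj fAB im pre] mf] fA].
have gE S : S `<=` A -> g @` S = f @` S.
  by move=> SA; apply: eq_imagel => x /SA /fg.
split; last by rewrite gE.
split; last by move=> S mS SA; rewrite gE// mf.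
split.
- by move=> x y Ax Ay; rewrite -!fg; [exact: inj|exact: set_mem..].
- by rewrite gE.
- by move=> S mS SA; rewrite gE//; exact: im.
- move=> S mS; rewrite (_ : _ `&` _ = A `&` f @^-1` S); first exact: pre.
  by apply/seteqP; split=> x [Ax]; rewrite /= fg.
Qed.

Lemma measure_iso_glue A1 A2 B1 B2 f1 f2 :
  measurable A1 -> measurable A2 -> A1 `&` A2 = set0 -> B1 `&` B2 = set0 ->
  measure_iso A1 B1 f1 -> measure_iso A2 B2 f2 ->
  measure_iso (A1 `|` A2) (B1 `|` B2)
    (fun x => if x \in A1 then f1 x else f2 x).
Proof.
move=> mA1 mA2 A12 B12 [e1 im1] [e2 im2]; split.
  exact: measure_embedding_glue.
rewrite image_setU -im1 -im2; congr (_ `|` _).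
  by apply: eq_imagel => x Ax; rewrite mem_set.
apply: eq_imagel => x Ax; case: ifPn => //; rewrite inE => A1x.
by have : set0 x by rewrite -A12.
Qed.

End isomorphism.

Lemma measure_iso_inverse d1 d2 (T1 : measurableType d1)
    (T2 : measurableType d2) (R : realType)
    (mu1 : {measure set T1 -> \bar R}) (mu2 : {measure set T2 -> \bar R})
    (A : set T1) (B : set T2) f : measurable A -> measure_iso mu1 mu2 A B f ->
  exists2 g, measure_iso mu2 mu1 B A g & {in A, cancel f g}.
Proof.
move=> mA [[[inj _ im pre] mf] fAB].
pose g := 'pinv_(fun=> point) A f.
have fK : {in A, cancel f g} by move=> x Ax; exact: pinvKV.
have mB : measurable B by rewrite -fAB; exact: im.
have gE S : S `<=` B -> g @` S = A `&` f @^-1` S.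
  move=> SB; apply/seteqP; split => [_ [y Sy <-]|x [Ax Sfx]].
    have := SB _ Sy; rewrite -fAB => -[x Ax fxy].
    by rewrite -fxy fK ?inE//; split=> //=; rewrite fxy.
  by exists (f x) => //; rewrite fK// inE.
have gB : g @` B = A.
  by rewrite gE//; apply: setIidl => x Ax /=; rewrite -fAB; exists x.
exists g => //; split=> //; split; last first.
  move=> S mS SB; rewrite gE// -mf//; last exact: pre.
  congr (mu2 _); apply/seteqP; split=> [_ [x [_ Sx] <-]//|y Sy].
  have := SB _ Sy; rewrite -fAB => -[x Ax fxy].
  by exists x => //; split=> //=; rewrite fxy.
split.
- move=> y y'; rewrite !inE -fAB => -[x Ax <-] [x' Ax' <-].
  by rewrite !fK ?inE// => ->.
- by rewrite gB.
- by move=> S mS SB; rewrite gE//; exact: pre.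
- move=> S mS.
  rewrite (_ : _ `&` _ = f @` (A `&` S)); first by apply: im;
    [exact: measurableI|move=> ? []].
  apply/seteqP; split=> [y []|_ [x [Ax Sx] <-]].
    by rewrite -fAB => -[x Ax <-] /=; rewrite fK ?inE// => Sx; exists x.
  by rewrite /= fK ?inE//; split=> //; rewrite -fAB; exists x.
Qed.

Lemma borel_embedding_comp d1 d2 d3 (T1 : measurableType d1)
    (T2 : measurableType d2) (T3 : measurableType d3)
    (A : set T1) (B : set T2) (C : set T3) f g :
  borel_embedding A B f -> borel_embedding B C g ->
  borel_embedding A C (g \o f).
Proof.
move=> [i1 s1 m1 p1] [i2 s2 m2 p2].
have fB x : A x -> B (f x) by move=> Ax; apply: s1; exists x.
split.
- move=> x y; rewrite !inE => Ax Ay e; apply: i1; rewrite ?inE//.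
  by apply: i2; rewrite ?inE//; exact: fB.
- by move=> _ [x Ax <-]; apply: s2; exists (f x) => //; exact: fB.
- move=> S mS SA; rewrite -image_comp; apply: m2; first exact: m1.
  by move=> _ [x Sx <-]; apply: fB; exact: SA.
- move=> S mS; rewrite (_ : _ `&` _ = A `&` f @^-1` (B `&` g @^-1` S)).
    by apply: p1; exact: p2.
  by apply/seteqP; split=> x [Ax] => [Sx|[_ Sx]]; split=> //; split=> //; exact: fB.
Qed.

Lemma measure_embedding_comp d1 d2 d3 (T1 : measurableType d1)
    (T2 : measurableType d2) (T3 : measurableType d3) (R : realType)
    (mu1 : set T1 -> \bar R) (mu2 : set T2 -> \bar R) (mu3 : set T3 -> \bar R)
    (A : set T1) (B : set T2) (C : set T3) f g :
  measure_embedding mu1 mu2 A B f -> measure_embedding mu2 mu3 B C g ->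
  measure_embedding mu1 mu3 A C (g \o f).
Proof.
move=> [bf ef] [bg eg]; split; first exact: borel_embedding_comp bg.
move=> S mS SA; have [_ fAB im _] := bf.
rewrite -image_comp eg ?ef//; first exact: im.
by apply: subset_trans fAB; exact: image_subset.
Qed.

Lemma measure_iso_comp d1 d2 d3 (T1 : measurableType d1)
    (T2 : measurableType d2) (T3 : measurableType d3) (R : realType)
    (mu1 : {measure set T1 -> \bar R}) (mu2 : {measure set T2 -> \bar R})
    (mu3 : {measure set T3 -> \bar R})
    (A : set T1) (B : set T2) (C : set T3) f g :
  measure_iso mu1 mu2 A B f -> measure_iso mu2 mu3 B C g ->
  measure_iso mu1 mu3 A C (g \o f).
Proof.
move=> [ef fA] [eg gB]; split; first exact: measure_embedding_comp eg.
by rewrite -image_comp fA gB.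
Qed.

Lemma measure_schroeder_bernstein d1 d2 (T1 : measurableType d1)
    (T2 : measurableType d2) (R : realType)
    (mu1 : {measure set T1 -> \bar R}) (mu2 : {measure set T2 -> \bar R})
    (A : set T1) (B : set T2) f g : measurable A -> measurable B ->
  measure_embedding mu1 mu2 A B f -> measure_embedding mu2 mu1 B A g ->
  exists h, measure_iso mu1 mu2 A B h.
Proof.
move=> mA mB ef eg.
have [[fi fAB fm _] _] := ef; have [[gi gBA gm _] _] := eg.
(* The points of [A] whose chain of preimages under [g] and [f] stops in [A]; [f] is used on them
   and the inverse of [g] on the rest. Only countably many images occur, so the split is
   measurable. *)
pose W_ := fix W n := if n is n'.+1 then g @` (f @` W n') else A `\` g @` B.
have mW n : measurable (W_ n) /\ W_ n `<=` A.
  elim: n => [|n [mW WA]].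
    split; last by move=> x [].
    by apply: measurableD => //; exact: gm.
  have fWB : f @` W_ n `<=` B.
    by apply: subset_trans fAB; exact: image_subset.
  split; first by apply: gm => //; exact: fm.
  by apply: subset_trans gBA; exact: image_subset.
pose W := \bigcup_n W_ n.
have mW' : measurable W by apply: bigcup_measurable => n _; case: (mW n).
have WA : W `<=` A by apply: bigcup_sub => n _; case: (mW n).
have mfW : measurable (f @` W) by exact: fm.
have fWB : f @` W `<=` B by apply: subset_trans fAB; exact: image_subset.
have gE : g @` (B `\` f @` W) = A `\` W.
  apply/seteqP; split=> [_ [y [By nWy] <-]|x [Ax nWx]].
    split; first by apply: gBA; exists y.
    move=> [[|n] _ /=]; first by case=> _; apply; exists y.
    move=> [_ [x Wx <-] /gi e]; apply: nWy; exists x; first by exists n.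
    apply: e; rewrite inE//; apply: fAB; exists x => //.
    by case: (mW n) => _; exact.
  have : (g @` B) x.
    by apply: contrapT => nB; apply: nWx; exists 0%N.
  move=> [y By gyx]; exists y => //; split=> // -[z [n _ Wz] fzy].
  by apply: nWx; exists n.+1 => //=; exists y => //; exists z.
have isoW := measure_embedding_iso (measure_embedding_sub mW' WA fWB ef).
have mBW : measurable (B `\` f @` W) by exact: measurableD.
have BWB : B `\` f @` W `<=` B by move=> ? [].
have gBWA : g @` (B `\` f @` W) `<=` A by rewrite gE => ? [].
have isoBW := measure_embedding_iso (measure_embedding_sub mBW BWB gBWA eg).
have [k isok _] := measure_iso_inverse mBW isoBW.
have mAW : measurable (A `\` W) by exact: measurableD.
rewrite gE in isok.
rewrite -(setDUK WA) -(setDUK fWB).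
exists (fun x => if x \in W then f x else k x).
apply: measure_iso_glue => //.
- by rewrite setDE setICA setICr setI0.
- by rewrite setDE setICA setICr setI0.
Qed.

(** * The cumulative distribution function of an atomless measure *)

(* The measure instance on [pushforward m f] depends on the measurability of
   [f], which unification cannot infer. *)
Lemma pushforward_measure d1 d2 (T1 : measurableType d1)
    (T2 : measurableType d2) (R : realType) (m : {measure set T1 -> \bar R})
    (f : T1 -> T2) : measurable_fun setT f ->
  exists m' : {measure set T2 -> \bar R}, forall B, m' B = m (f @^-1` B).
Proof.
move=> mf.
by exists (measure_function_pushforward__canonical__measure_function_Measure m mf).
Qed.

Lemma measure_bigcup_null d (T : measurableType d) (R : realType)
    (mu : {measure set T -> \bar R}) (F : (set T)^nat) :
  (forall k, measurable (F k)) -> (forall k, mu (F k) = 0%E) ->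
  mu (\bigcup_k F k) = 0%E.
Proof.
move=> mF F0; apply/eqP; rewrite eq_le measure_ge0 andbT.
apply: le_trans (generalized_Boole_inequality mu mF _) _.
  exact: bigcupT_measurable.
by rewrite eseries0.
Qed.

Section rays.
Context (R : realType).
Local Notation mR := (measurableTypeR R).
Implicit Types m : {measure set mR -> \bar R}.

(** Half-open intervals form a generating pi-system, and finiteness on rays allows their measures to
    be written as differences of those of rays. *)
Lemma measure_rays_unique m1 m2 :
  (forall b : R, m1 `]-oo, b]%classic = m2 `]-oo, b]%classic) ->
  (forall b : R, (m1 `]-oo, b]%classic < +oo)%E) ->
  forall A, measurable A -> m1 A = m2 A.
Proof.
move=> m12 m1fin.
apply: (@measure_unique _ R mR (@ocitv R) (fun k => `](- k%:R), k%:R]%classic)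
  _ _ _ _ m1 m2) => //.
- exact: ocitvI.
- move=> k; exact: is_ocitv.
- apply/seteqP; split=> // x _; exists (Num.trunc `|x|).+1 => //=.
  have := truncnS_gt `|x|; rewrite in_itv/= => /[dup] h.
  by rewrite ltr_norml => /andP[-> /ltW ->].
- move=> _ [[a b] _ <-] /=.
  have E m : (m `]-oo, b]%classic < +oo)%E ->
      m `]a, b]%classic = (m `]-oo, b]%classic - m (`]-oo, b] `&` `]-oo,
        a])%classic)%E.
    move=> mb; rewrite -measureD//.
    congr (m _); apply/seteqP; split=> x /=; rewrite !in_itv/=.
      by move=> /andP[ax ->]; split=> //; rewrite leNgt ax.
    by move=> [-> /negP]; rewrite -ltNge => ->.
  have I : (`]-oo, b] `&` `]-oo, a])%classic = `]-oo, Num.min b a]%classic :> set mR.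
    by apply/seteqP; split=> x /=; rewrite !in_itv/= le_min => /andP.
  rewrite E; last exact: m1fin.
  rewrite E; last by rewrite -m12; exact: m1fin.
  by rewrite I !m12.
- move=> k; apply: le_lt_trans (m1fin k%:R); apply: le_measure; rewrite ?inE//.
  by move=> x /=; rewrite !in_itv/= => /andP[].
Qed.

(** Kept as a measure on the whole line: the negative half-line is the room for the null set on
    which a cumulative distribution function fails to be injective. *)
Definition half_lebesgue : set mR -> \bar R :=
  mrestr (@lebesgue_measure R) (measurable_itv `[0, +oo[).

HB.instance Definition _ := Measure.on half_lebesgue.

Lemma half_lebesgue_ray (b : R) :
  half_lebesgue `]-oo, b]%classic = (Num.max 0 b)%:E.
Proof.
rewrite /half_lebesgue /mrestr.
have -> : (`]-oo, b] `&` `[0%R, +oo[)%classic = `[0, b]%classic :> set R.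
  apply/seteqP; split=> x /=; rewrite !in_itv/= andbT.
    by move=> [-> ->].
  by move=> /andP[-> ->].
rewrite lebesgue_measure_itv/= lte_fin.
by case: ltP => // b0; rewrite oppr0 adde0.
Qed.

End rays.

Section cumulative_function.
Context (R : realType).
Local Notation mR := (measurableTypeR R).
Variable nu : {measure set mR -> \bar R}.
Hypothesis nu_fin : forall x : R, (nu `]-oo, x]%classic < +oo)%E.
Hypothesis nu_atomless : forall x : R, nu [set x] = 0%E.
Hypothesis nu_nonpos : nu `]-oo, 0]%classic = 0%E.
Hypothesis nu_infinite : nu setT = +oo%E.

Definition cdf_of (x : R) : R := fine (nu `]-oo, x]%classic).
(** The right-continuous inverse: for [y >= 0] it picks the largest point where the cumulative
    distribution function is at most [y], which yields the Galois connection [cdf_of_le]. For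
    [y < 0] the set is empty and its [sup] is 0. *)
Definition quantile (y : R) : R := sup [set x | cdf_of x <= y].
Local Notation F := cdf_of.
Local Notation G := quantile.

Lemma cdf_ofE x : nu `]-oo, x]%classic = (F x)%:E.
Proof. by rewrite fineK// ge0_fin_numE. Qed.

Lemma cdf_of_homo : {homo F : x y / x <= y}.
Proof.
move=> x y xy; rewrite -lee_fin -!cdf_ofE; apply: le_measure; rewrite ?inE//.
by apply: subitvPr; rewrite bnd_simp.
Qed.

Lemma cdf_of_ge0 x : 0 <= F x.
Proof. by rewrite -lee_fin -cdf_ofE. Qed.

Lemma cdf_of0 : F 0 = 0. Proof. by rewrite /F nu_nonpos. Qed.

Lemma cdf_of_unbounded y : exists x, y < F x.
Proof.
apply: contrapT => /forallNP bnd.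
pose U n : set R := `]-oo, n%:R]%classic.
have UT : \bigcup_n U n = setT.
  apply/seteqP; split=> // x _; exists (Num.trunc `|x|).+1 => //=.
  by rewrite /U/= in_itv/= (le_trans (ler_norm _))// ltW// truncnS_gt.
have := @nondecreasing_cvg_mu _ mR R nu U (fun=> measurable_itv _).
rewrite UT => /(_ measurableT) cvgU.
have : (limn (nu \o U) <= y%:E)%E.
  apply: lime_le; first apply: cvgP; first apply: cvgU.
    move=> m n mn; apply/subsetPset; apply: subitvPr.
    by rewrite bnd_simp ler_nat.
  by apply: nearW => n /=; rewrite /U cdf_ofE lee_fin leNgt; exact/negP/bnd.
rewrite (cvg_lim _ (cvgU _))// ?nu_infinite//.
move=> m n mn; apply/subsetPset; apply: subitvPr.
by rewrite bnd_simp ler_nat.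
Qed.

Lemma sublevel_has_sup y : 0 <= y -> has_sup [set x | F x <= y].
Proof.
move=> y0; split; first by exists 0; rewrite /= cdf_of0.
have [z yz] := cdf_of_unbounded y; exists z => x /= Fxy.
rewrite leNgt; apply/negP => /ltW/cdf_of_homo Fzx.
by have := lt_le_trans yz (le_trans Fzx Fxy); rewrite ltxx.
Qed.

Lemma cdf_of_lt_quantile x y : 0 <= y -> x < G y -> F x <= y.
Proof.
move=> y0 /sup_gt[|z /= Fzy xz]; first exact: (sublevel_has_sup y0).1.
by apply: le_trans Fzy; apply: cdf_of_homo; exact: ltW.
Qed.

Lemma cdf_of_gt_quantile x y : 0 <= y -> G y < x -> y < F x.
Proof.
move=> y0 Gx; rewrite ltNge; apply/negP => Fxy.
have := sup_upper_bound (sublevel_has_sup y0) Fxy.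
by rewrite leNgt Gx.
Qed.

(** This is continuity of [F] at [G y]: from the left by continuity of measure from below and the
    absence of atoms, from the right by continuity from above on rays of finite measure. *)
Lemma quantileK y : 0 <= y -> F (G y) = y.
Proof.
move=> y0; apply/eqP; rewrite eq_le -!lee_fin -!cdf_ofE; apply/andP; split.
- pose U n : set R := `]-oo, G y - n.+1%:R^-1]%classic.
  have UT : \bigcup_n U n = `]-oo, G y[%classic.
    apply/seteqP; split=> x /=.
      move=> [n _]; rewrite /U /= !in_itv/= => /le_lt_trans; apply.
      by rewrite ltrBlDr ltrDl invr_gt0.
    rewrite in_itv/= => xG; exists (Num.trunc (G y - x)^-1) => //.
    rewrite /U/= in_itv/= lerBrDl -lerBrDr ltW// invf_plt ?posrE ?subr_gt0//.
    exact: truncnS_gt.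
  have homoU : {homo U : n m / (n <= m)%N >-> (n <= m)%O}.
    move=> m n mn; apply/subsetPset; apply: subitvPr.
    by rewrite bnd_simp lerB// lef_pV2 ?posrE// ler_nat.
  have := @nondecreasing_cvg_mu _ mR R nu U (fun=> measurable_itv _).
  rewrite UT => /(_ (measurable_itv _) homoU) cvgU.
  have -> : nu `]-oo, G y]%classic = nu `]-oo, G y[%classic.
    rewrite -(@setUitv1 _ _ -oo%O (G y) true)// measureU//= ?nu_atomless ?adde0//.
    apply/seteqP; split=> x //= [] /[swap] ->; by rewrite in_itv/= ltxx.
  rewrite -(cvg_lim _ cvgU)//; apply: lime_le; first exact: cvgP cvgU.
  apply: nearW => n /=; rewrite /U cdf_ofE lee_fin; apply: cdf_of_lt_quantile => //.
  by rewrite ltrBlDr ltrDl invr_gt0.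
- pose U n : set R := `]-oo, G y + n.+1%:R^-1]%classic.
  have UT : \bigcap_n U n = `]-oo, G y]%classic.
    apply/seteqP; split=> x /=; last first.
      move=> + n _; rewrite /U /= !in_itv/= => /le_trans; apply.
      by rewrite lerDl invr_ge0.
    rewrite in_itv/= => xG; rewrite leNgt; apply/negP => Gx.
    have := xG (Num.trunc (x - G y)^-1) Logic.I.
    rewrite /U/= in_itv/= leNgt => /negP; apply.
    rewrite -ltrBrDl invf_plt ?posrE ?subr_gt0//.
    exact: truncnS_gt.
  have homoU : {homo U : n m / (n <= m)%N >-> (m <= n)%O}.
    move=> m n mn; apply/subsetPset; apply: subitvPr.
    by rewrite bnd_simp lerD// lef_pV2 ?posrE// ler_nat.
  have := @nonincreasing_cvg_mu _ mR R nu U (nu_fin _) (fun=> measurable_itv _).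
  rewrite UT => /(_ (measurable_itv _) homoU) cvgU.
  rewrite -(cvg_lim _ cvgU)//; apply: lime_ge; first exact: cvgP cvgU.
  apply: nearW => n /=; rewrite /U cdf_ofE lee_fin; apply: ltW.
  by apply: cdf_of_gt_quantile => //; rewrite ltrDl invr_gt0.
Qed.

Lemma cdf_of_le x y : 0 <= y -> (F x <= y) = (x <= G y).
Proof.
move=> y0; apply/idP/idP => [Fxy|/cdf_of_homo]; last by rewrite quantileK.
exact: (sup_upper_bound (sublevel_has_sup y0)).
Qed.

Lemma quantile_neg y : y < 0 -> G y = 0.
Proof.
move=> y0; rewrite /G (_ : [set x | _] = set0) ?sup0//.
by apply/seteqP; split=> // x /= /(le_trans (cdf_of_ge0 x)); rewrite leNgt y0.
Qed.

Lemma quantile_ge0 y : 0 <= G y.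
Proof.
have [y0|/quantile_neg ->//] := leP 0 y.
by rewrite -cdf_of_le// cdf_of0.
Qed.

Lemma quantile_homo : {homo G : x y / x <= y}.
Proof.
move=> x y xy; have [x0|/quantile_neg ->] := leP 0 x; last exact: quantile_ge0.
by rewrite -cdf_of_le ?quantileK// (le_trans x0).
Qed.

Lemma measurable_cdf_of : measurable_fun setT (F : mR -> mR).
Proof. by apply: nondecreasing_measurable => //; exact: cdf_of_homo. Qed.

Lemma measurable_quantile : measurable_fun setT (G : mR -> mR).
Proof. by apply: nondecreasing_measurable => //; exact: quantile_homo. Qed.

(** The probability integral transform: for [b >= 0], the preimage of the ray up to [b] is the ray
    up to [G b], of mass [F (G b) = b]. *)
Lemma measure_preimage_cdf_of (B : set mR) : measurable B ->
  nu (F @^-1` B) = half_lebesgue B.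
Proof.
move=> mB; have [m1 m1E] := pushforward_measure nu measurable_cdf_of.
have rayE b : m1 `]-oo, b]%classic = (Num.max 0 b)%:E.
  rewrite m1E; have [b0|b0] := ltP b 0.
    rewrite (_ : _ @^-1` _ = set0) ?measure0//.
    apply/seteqP; split=> // x /=; rewrite in_itv/=.
    by move=> /(le_trans (cdf_of_ge0 x)); rewrite leNgt b0.
  rewrite (_ : _ @^-1` _ = `]-oo, G b]%classic).
    by rewrite cdf_ofE quantileK.
  by apply/seteqP; split=> x /=; rewrite !in_itv/= cdf_of_le.
rewrite -m1E; apply: (@measure_rays_unique R m1 (@half_lebesgue R)) => //.
- by move=> b; rewrite rayE; exact/esym/half_lebesgue_ray.
- by move=> b; rewrite rayE ltry.
Qed.

(** The points that are the right ends of their level sets of [F]; there [G] inverts [F]. *)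
Definition cdf_regular : set mR := [set x | G (F x) == x].

Lemma measurable_cdf_regular : measurable cdf_regular.
Proof.
rewrite /cdf_regular -[[set _ | _]]setTI.
have : measurable_fun setT (fun x : mR => G (F x) == x).
  apply: measurable_fun_eqr => //.
  by apply: (measurableT_comp measurable_quantile); exact: measurable_cdf_of.
by move=> /(_ measurableT [set true]); exact.
Qed.

(* Off the regular set, [F x = F q] for some rational [q], so [x] is in one of
   countably many level sets of [F], which are null. *)
Lemma cdf_regular_conull : nu (~` cdf_regular) = 0%E.
Proof.
pose L (q : rat) : set mR := F @^-1` [set F (ratr q)].
have mL q : measurable (L q).
  by rewrite /L -[_ @^-1` _]setTI; apply: measurable_cdf_of.
have L0 q : nu (L q) = 0%E.
  rewrite /L measure_preimage_cdf_of// /half_lebesgue /mrestr.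
  by apply: (subset_measure0 _ _ _ (lebesgue_measure_set1 (F (ratr q))));
    [exact: measurableI|exact: measurable_set1|move=> ? []].
pose L' k := if unpickle k is Some q then L q else set0.
have mL' k : measurable (L' k) by rewrite /L'; case: unpickle.
have L'0 k : nu (L' k) = 0%E by rewrite /L'; case: unpickle => [q|//]; exact: L0.
apply: (subset_measure0 _ _ _ (measure_bigcup_null mL' L'0)).
- by apply: measurableC; exact: measurable_cdf_regular.
- exact: bigcupT_measurable.
- move=> x /negP xr; have Fx0 := cdf_of_ge0 x.
  have xG : x < G (F x).
    by rewrite lt_neqAle eq_sym xr/= -cdf_of_le ?lexx.
  have [q xq qG] : exists2 q : rat, x <= ratr q & ratr q <= G (F x).
    have [q] := rat_in_itvoo xG; rewrite in_itv/= => /andP[xq qG].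
    by exists q; exact: ltW.
  exists (pickle q); first exact: Logic.I.
  rewrite /L' pickleK; apply/eqP.
  by rewrite eq_le (cdf_of_homo xq)/= cdf_of_le.
Qed.

Lemma cdf_of_embedding : measure_embedding nu (@half_lebesgue R)
  cdf_regular `[0, +oo[%classic F.
Proof.
have GK : {in cdf_regular, cancel F G} by move=> x; rewrite inE => /eqP.
have bF : borel_embedding cdf_regular (`[0%R, +oo[%classic : set mR)
    (F : mR -> mR).
  apply: (@borel_embedding_left_inverse _ _ _ _ R _ _ _ (G : mR -> mR) id) => //.
  - exact: measurable_cdf_regular.
  - exact: measurable_cdf_of.
  - exact: measurable_quantile.
  - by move=> _ [x _ <-] /=; rewrite in_itv/= cdf_of_ge0.
split=> // S mS SA; have [_ _ im _] := bF.
rewrite -measure_preimage_cdf_of; last exact: im.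
have mI : measurable (F @^-1` (F @` S)).
  by rewrite -[_ @^-1` _]setTI; apply: measurable_cdf_of => //; exact: im.
have mr := measurable_cdf_regular.
(* [F] is injective on the regular set, so saturating [S] adds only non-regular points, which are
   null. *)
rewrite (_ : F @^-1` _ = S `|` (F @^-1` (F @` S) `&` ~` cdf_regular)).
  rewrite measureU0//.
    by apply: measurableI => //; exact: measurableC.
  apply: (subset_measure0 _ _ _ cdf_regular_conull).
  - by apply: measurableI => //; exact: measurableC.
  - exact: measurableC.
  - by move=> ? [].
apply/seteqP; split=> [x|x [Sx|[]//]]; last by exists x.
have [xr|xr] := pselect (cdf_regular x); last by right.
move=> [z Sz zx]; left; have : G (F z) = G (F x) by rewrite zx.
by rewrite !GK ?inE//; [move=> <-|exact: SA].
Qed.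

Lemma quantile_embedding : borel_embedding (`]0, +oo[%classic : set mR)
  (setT : set mR) (G : mR -> mR).
Proof.
apply: (@borel_embedding_left_inverse _ _ _ _ R _ _ _ (F : mR -> mR) id) => //.
- exact: measurable_quantile.
- exact: measurable_cdf_of.
- by move=> y; rewrite inE/= in_itv/= andbT => /ltW; exact: quantileK.
Qed.

(** [F] exceeds [y] immediately to the right of [G y], so every neighbourhood of [G y] has positive
    mass: [G y] is in the support of [nu], which a co-null closed set contains. *)
Lemma quantile_closed (K : set R) : closed K -> nu (~` K) = 0%E ->
  forall y, 0 <= y -> K (G y).
Proof.
move=> cK K0 y y0; apply: contrapT => nK.
have : nbhs (G y) (~` K) by apply: open_nbhs_nbhs; split=> //; exact: closed_openC.
move=> /nbhs_ballP[e /= e0 Ke].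
have mK : measurable (~` K : set mR).
  by apply: measurableC; exact: closed_measurable.
have I0 : nu `]G y, G y + e / 2]%classic = 0%E.
  apply: (subset_measure0 _ mK _ K0) => // x /=; rewrite in_itv/= => /andP[Gx xe].
  apply: Ke; rewrite /ball/= ler0_norm ?subr_le0 ?ltW//.
  rewrite opprB ltrBlDl (le_lt_trans xe)// ltrD2l ltr_pdivrMr// ltr_pMr//.
  by rewrite ltr1n.
have e20 : 0 < e / 2 by exact: divr_gt0.
have : y < F (G y + e / 2) by apply: cdf_of_gt_quantile => //; rewrite ltrDl.
rewrite -lte_fin -cdf_ofE (@itv_bndbnd_setU _ _ -oo%O (BRight (G y)))//; last first.
  by rewrite bnd_simp lerDl ltW.
rewrite measureU//; last first.
  apply/seteqP; split=> // x [] /=; rewrite !in_itv/= => xG /andP[].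
  by rewrite ltNge xG.
rewrite [X in (_ + X)%E]I0 adde0 [X in (_ < X)%E](cdf_ofE (G y)) quantileK//.
by rewrite ltxx.
Qed.

End cumulative_function.

(** * Greedy expansions and the encoding of row vectors by reals *)

Section expansion.
Context (R : realType) (r : R) (b : nat).
Hypotheses (r_gt0 : 0 < r) (br_lt1 : b.+1%:R * r < 1).
Implicit Types (a : nat -> nat) (y : R).

Definition expansion_sum N a : R := \sum_(k < N) (a k)%:R * r ^+ k.+1.
Definition expansion a : R := limn (expansion_sum ^~ a).
Definition tail_of a : nat -> nat := a \o S.

(* The greedy expansion of [y] in base [1 / r]. *)
Fixpoint residue k y : R :=
  if k is k'.+1 then residue k' y / r - (Num.truncn (residue k' y / r))%:R else y.
Definition digit k y : nat := Num.truncn (residue k y / r).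

(** The value of the expansion all of whose digits are [b]. It is below 1 because [b.+1%:R * r < 1],
    and this gap rules out two expansions of one number. *)
Let bound : R := b%:R * r / (1 - r).

Let r_lt1 : 0 < 1 - r.
Proof.
rewrite subr_gt0; apply: le_lt_trans br_lt1.
by rewrite -[leLHS]mul1r ler_wpM2r ?ler1n// ltW.
Qed.

Let bound_ge0 : 0 <= bound.
Proof. by rewrite /bound divr_ge0 ?mulr_ge0 ?ler0n// ltW. Qed.

Let bound_lt1 : bound < 1.
Proof.
by rewrite /bound ltr_pdivrMr// mul1r ltrBrDr -[X in _ + X]mul1r -mulrDl natr1.
Qed.

Lemma expansion_sumS N a :
  expansion_sum N.+1 a = r * ((a 0%N)%:R + expansion_sum N (tail_of a)).
Proof.
rewrite /expansion_sum big_ord_recl/= expr1 mulrDr mulrC; congr (_ + _).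
by rewrite mulr_sumr; apply: eq_bigr => i _; rewrite /bump/= add1n exprS mulrCA.
Qed.

Lemma expansion_sum_le N a : (forall k, (a k <= b)%N) -> expansion_sum N a <= bound.
Proof.
elim: N a => [|N ih] a ab; first by rewrite /expansion_sum big_ord0.
rewrite expansion_sumS (@le_trans _ _ (r * (b%:R + bound)))//.
  by rewrite ler_pM2l// lerD ?ler_nat// ih// => k; exact: ab.
rewrite le_eqVlt; apply/orP; left; apply/eqP; rewrite /bound.
by field; rewrite gt_eqF.
Qed.

Lemma expansion_sum_homo a : {homo expansion_sum^~ a : m n / (m <= n)%N >-> m <= n}.
Proof.
apply/nondecreasing_seqP => n; rewrite /expansion_sum big_ord_recr/= lerDl.
by rewrite mulr_ge0 ?exprn_ge0 ?ler0n// ltW.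
Qed.

Lemma cvg_expansion a : (forall k, (a k <= b)%N) ->
  expansion_sum N a @[N --> \oo] --> expansion a.
Proof.
move=> ab; apply: nondecreasing_is_cvgn; first exact: expansion_sum_homo.
by exists bound => _ [N _ <-]; exact: expansion_sum_le.
Qed.

Lemma expansion_rec a : (forall k, (a k <= b)%N) ->
  expansion a = r * ((a 0%N)%:R + expansion (tail_of a)).
Proof.
move=> ab; apply/cvg_lim => //; rewrite -cvg_shiftS/=.
rewrite (_ : (fun n => _) =
    (fun n => r * ((a 0%N)%:R + expansion_sum n (tail_of a)))); last first.
  by apply/funext => n; exact: expansion_sumS.
apply: cvgMr; apply: cvgD; first exact: cvg_cst.
by apply: cvg_expansion => k; exact: ab.
Qed.

Lemma expansion_ge0 a : (forall k, (a k <= b)%N) -> 0 <= expansion a.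
Proof.
move=> /cvg_expansion h; apply: limr_ge; first exact: cvgP h.
apply: nearW => N; rewrite /expansion_sum sumr_ge0// => k _.
by rewrite mulr_ge0 ?exprn_ge0 ?ler0n// ltW.
Qed.

Lemma expansion_lt1 a : (forall k, (a k <= b)%N) -> expansion a < 1.
Proof.
move=> ab; have h := cvg_expansion ab; apply: le_lt_trans bound_lt1.
by apply: limr_le; [exact: cvgP h|apply: nearW => N; exact: expansion_sum_le].
Qed.

(** The residue is the expansion of the shifted sequence; divided by [r] it is [a k] plus a number
    in [0, 1[, so truncation returns [a k]. *)
Lemma digit_residue_expansion k a : (forall k, (a k <= b)%N) ->
  residue k (expansion a) = expansion (fun j => a (k + j)%N) /\
  digit k (expansion a) = a k.
Proof.
move=> ab.
have dE j : residue j (expansion a) = expansion (fun i => a (j + i)%N) ->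
    residue j (expansion a) / r = (a j)%:R + expansion (fun i => a (j.+1 + i)%N).
  move=> ->; rewrite expansion_rec//.
  rewrite mulrC mulKf ?gt_eqF// addn0; congr (_ + expansion _).
  by apply/funext => i; rewrite /tail_of/= addnS addSn.
have tE j : residue j (expansion a) = expansion (fun i => a (j + i)%N) ->
    Num.truncn (residue j (expansion a) / r) = a j.
  move=> /dE ->; apply: truncn_def; rewrite lerDl expansion_ge0//=.
  by rewrite -natr1 ltrD2l expansion_lt1.
have rE : residue k (expansion a) = expansion (fun j => a (k + j)%N).
  elim: k => [//|k ih]/=; rewrite tE// dE//.
  by rewrite addrAC subrr add0r.
by split=> //; exact: tE.
Qed.

Lemma digit_expansion k a : (forall k, (a k <= b)%N) -> digit k (expansion a) = a k.
Proof. by move=> /digit_residue_expansion => /(_ k)[]. Qed.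

Lemma expansion_inj a a' : (forall k, (a k <= b)%N) -> (forall k, (a' k <= b)%N) ->
  expansion a = expansion a' -> a = a'.
Proof. by move=> h h' e; apply/funext => k; rewrite -(digit_expansion k h) e
  digit_expansion. Qed.

Local Notation mR := (measurableTypeR R).

Lemma measurable_truncn_div (f : mR -> mR) : measurable_fun setT f ->
  measurable_fun setT (fun y => (Num.truncn (f y / r))%:R : mR).
Proof.
move=> mf.
have mt : measurable_fun setT (fun y : mR => (Num.truncn (y / r))%:R : mR).
  apply: nondecreasing_measurable => // x y xy; rewrite ler_nat le_truncn//.
  by rewrite ler_pM2r// invr_gt0.
exact: (measurableT_comp mt mf).
Qed.

Lemma measurable_residue k : measurable_fun setT (residue k : mR -> mR).
Proof.
elim: k => [|k ih]/=; first exact: measurable_id.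
apply: measurable_funB; last exact: measurable_truncn_div.
by apply: measurable_funM => //; exact: measurable_cst.
Qed.

Lemma measurable_digit k : measurable_fun setT (fun y : mR => (digit k y)%:R : mR).
Proof. by apply: measurable_truncn_div; exact: measurable_residue. Qed.

Lemma measurable_digit_set k (P : set nat) : measurable [set y : mR | P (digit k y)].
Proof.
rewrite -[[set _ | _]]setTI.
rewrite (_ : [set _ | _] = (fun y : mR => (digit k y)%:R : mR) @^-1`
    \bigcup_(j in P) [set j%:R]).
  apply: measurable_digit => //; apply: bigcup_measurable => j _.
  exact: measurable_set1.
apply/seteqP; split=> y /=; first by move=> Py; exists (digit k y).
by move=> [j Pj /= /eqP]; rewrite eqr_nat => /eqP ->.
Qed.

Lemma measurable_expansion d (T : measurableType d) (a : T -> nat -> nat) :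
  (forall x k, (a x k <= b)%N) ->
  (forall k, measurable_fun setT (fun x => (a x k)%:R : mR)) ->
  measurable_fun setT (fun x => expansion (a x) : mR).
Proof.
move=> ab ma.
apply: (measurable_fun_cvg (h := fun N x => expansion_sum N (a x))).
  move=> N; rewrite /expansion_sum; apply: measurable_sum => k.
  by apply: measurable_funM => //; exact: ma.
by move=> x _; exact: cvg_expansion.
Qed.

End expansion.

Section borel_row.
Context (R : realType) (n : nat).
Local Notation mR := (measurableTypeR R).

(** Pieces are compared with all their Borel subsets; the smaller sigma-algebra of the theorem comes
    in only when they are glued. *)
Definition borel_row : Type := g_sigma_algebraType (@open 'rV[R]_n).
HB.instance Definition _ := Measurable.on borel_row.

Lemma measurable_open_row (U : set 'rV[R]_n) : open U -> measurable (U : set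
  borel_row).
Proof. by move=> oU; exact: sub_sigma_algebra. Qed.

(** Open cubes from a countable family: they serve as a basis for measurability, and later as the
    letters in which covers are coded. *)
Definition rational_ball (c : 'rV[rat]_n * rat) : set 'rV[R]_n :=
  [set z | forall i, `|z ord0 i - ratr (c.1 ord0 i)| < ratr c.2].

Lemma measurable_coord (i : 'I_n) :
  measurable_fun setT (fun z : borel_row => z ord0 i : mR).
Proof.
apply: (@measurability _ _ borel_row mR setT _ (@RGenOpens.G R)
  (@RGenOpens.measurableE R)) => _ [_ [a [b ->]] <-].
rewrite setTI; apply: measurable_open_row.
by apply: open_comp; [move=> z _; exact: coord_continuous|exact: interval_open].
Qed.

Lemma measurable_preimage_rational_ball d (T : measurableType d) (f : T ->
  borel_row) c :
  (forall i, measurable_fun setT (fun x => f x ord0 i : mR)) ->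
  measurable (f @^-1` rational_ball c).
Proof.
move=> mf.
rewrite (_ : _ @^-1` _ = \bigcap_(i in [set: 'I_n])
    [set x | `|f x ord0 i - ratr (c.1 ord0 i)| < ratr c.2]); last first.
  by apply/seteqP; split=> x /= h i; [move=> _; exact: h|exact: h].
apply: fin_bigcap_measurable => // i _; rewrite -[[set _ | _]]setTI.
have : measurable_fun setT (fun x => `|f x ord0 i - ratr (c.1 ord0 i)| < ratr c.2).
  apply: measurable_fun_ltr => //; apply: measurableT_comp => //.
  by apply: measurable_funB => //; exact: mf.
by move=> /(_ measurableT [set true]); exact.
Qed.

Lemma measurable_rational_ball c : measurable (rational_ball c : set borel_row).
Proof. by apply: (@measurable_preimage_rational_ball _ _ id);
  exact: measurable_coord. Qed.

Lemma rational_center (z : 'rV[R]_n) (e : R) : 0 < e ->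
  exists q : 'rV[rat]_n, forall i, `|z ord0 i - ratr (q ord0 i)| < e.
Proof.
move=> e0.
have /choice[q qP] : forall i : 'I_n, exists q : rat, `|z ord0 i - ratr q| < e.
  move=> i; have [|q] := @rat_in_itvoo R (z ord0 i - e) (z ord0 i + e).
    by rewrite ltrD2l -subr_gt0 opprK addr_gt0.
  rewrite in_itv/= => qe; exists q; rewrite distrC ltr_norml.
  by rewrite ltrBrDr ltrBlDr addrC [e + _]addrC.
by exists (\row_i q i) => i; rewrite mxE.
Qed.

Lemma rational_ball_basis (U : set 'rV[R]_n) z : open U -> U z ->
  exists c, rational_ball c z /\ rational_ball c `<=` U.
Proof.
move=> oU Uz; have : nbhs z U by exact: open_nbhs_nbhs.
move=> /nbhs_ballP[e /= e0 eU].
have [|p] := @rat_in_itvoo R 0 (e / 2); first exact: divr_gt0.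
rewrite in_itv/= => /andP[p0 pe].
have [q qp] := rational_center z p0.
exists (q, p); split=> // y yp; apply: eU; split=> // i j; rewrite ord1.
rewrite /ball/= (le_lt_trans (ler_distD (ratr (q ord0 j)) _ _))//.
rewrite [e]splitr; apply: ltrD; first exact: lt_trans (qp j) pe.
by rewrite distrC; exact: lt_trans (yp j) pe.
Qed.

Lemma measurable_fun_row d (T : measurableType d) (f : T -> borel_row) :
  (forall i, measurable_fun setT (fun x => f x ord0 i : mR)) ->
  measurable_fun setT f.
Proof.
move=> mf; apply: (@measurability _ _ T borel_row setT f (@open 'rV[R]_n) erefl)
  => _ [U oU <-].
rewrite setTI (_ : _ @^-1` _ = \bigcup_c (f @^-1` (rational_ball c) `&`
    [set x | rational_ball c `<=` U])); last first.
  apply/seteqP; split=> [x Ux|x [c _ [cx]]]; last exact.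
  by have [c [cx cU]] := rational_ball_basis oU Ux; exists c.
apply: countable_bigcupT_measurable => // c; apply: measurableI.
  exact: measurable_preimage_rational_ball.
have [cU|ncU] := pselect (rational_ball c `<=` U).
  by rewrite (_ : [set _ | _] = setT)//; apply/seteqP; split.
by rewrite (_ : [set _ | _] = set0)//; apply/seteqP; split.
Qed.

End borel_row.

Section encoding.
Context (R : realType) (n : nat).
Local Notation mR := (measurableTypeR R).
Local Notation B := (borel_row R n).

(** Base 4 with digits 0 and 1: in base 2 the gap condition would fail and dyadic numbers would have
    two expansions. *)
Let quarter : R := 4^-1.
Let quarter_gt0 : 0 < quarter. Proof. by rewrite invr_gt0. Qed.
Let quarter_lt1 : 2%:R * quarter < 1.
Proof. by rewrite /quarter; lra. Qed.

(* The Dedekind cuts of all the coordinates, as a single sequence of bits. *)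
Definition cut_bit (z : 'rV[R]_n) (k : nat) : nat :=
  if @unpickle ('I_n * rat)%type k is Some (i, q) then (z ord0 i < ratr q)%R else
    false.
Definition encode_row (z : B) : mR := expansion quarter (cut_bit z).
(** A coordinate is recovered as the infimum of the rationals marked as exceeding it. Irrelevant
    indices contribute [+oo], and [fine] makes the map total on reals that encode nothing. *)
Definition decode_row (y : mR) : B := \row_i fine (einfs (fun k =>
  if @unpickle ('I_n * rat)%type k is Some (j, q) then
    if (j == i) && (digit quarter k y == 1%N) then (ratr q)%:E else +oo
  else +oo)%E 0%N).

Let cut_bit_le1 z k : (cut_bit z k <= 1)%N.
Proof. by rewrite /cut_bit; case: unpickle => [[i q]|//]; case: (_ < _). Qed.

Lemma encode_row_ge0 z : 0 <= encode_row z.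
Proof. exact: (expansion_ge0 (b := 1)). Qed.

Lemma encode_row_lt1 z : encode_row z < 1.
Proof. exact: (expansion_lt1 (b := 1)). Qed.

Lemma encode_rowK : cancel encode_row decode_row.
Proof.
move=> z; apply/rowP => i; rewrite mxE.
suff -> : einfs (fun k =>
  if @unpickle ('I_n * rat)%type k is Some (j, q) then
    if (j == i) && (digit quarter k (encode_row z) == 1%N) then (ratr q)%:E else +oo
  else +oo)%E 0%N = (z ord0 i)%:E by [].
apply/eqP; rewrite eq_le; apply/andP; split.
- apply/lee_addgt0Pr => e e0.
  have [|q] := @rat_in_itvoo R (z ord0 i) (z ord0 i + e); first by rewrite ltrDl.
  rewrite in_itv/= => /andP[zq qe].
  apply: (@le_trans _ _ (ratr q)%:E); last by rewrite lee_fin ltW.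
  apply: ereal_inf_lbound; exists (pickle (i, q)) => //=.
  by rewrite pickleK eqxx (@digit_expansion _ _ 1)//= /cut_bit pickleK zq.
- apply: le_ereal_inf_tmp => _ [k _ <-].
  rewrite (@digit_expansion _ _ 1)// /cut_bit; case: unpickle => [[j q]|];
    last exact: leey.
  have [->/=|_] := eqVneq j i; last exact: leey.
  by case: ltP => [/ltW|_]; rewrite ?lee_fin ?leey.
Qed.

Lemma measurable_encode_row : measurable_fun setT encode_row.
Proof.
apply: (measurable_expansion (b := 1)) => // k; rewrite /cut_bit.
case: unpickle => [[i q]|]; last exact: measurable_cst.
rewrite (_ : (fun z : B => _) = (fun z : B => if z ord0 i < ratr q then 1 else 0
  : mR)).
  apply: measurable_fun_ifT; [|exact: measurable_cst..].
  by apply: measurable_fun_ltr; [exact: measurable_coord|exact: measurable_cst].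
by apply/funext => z; case: (_ < _).
Qed.

Lemma measurable_decode_row : measurable_fun setT decode_row.
Proof.
apply: measurable_fun_row => i.
rewrite (_ : (fun y => _) = (fun y => fine (einfs (fun k =>
  if @unpickle ('I_n * rat)%type k is Some (j, q) then
    if (j == i) && (digit quarter k y == 1%N) then (ratr q)%:E else +oo
  else +oo)%E 0%N))); last by apply/funext => y; rewrite mxE.
apply: (measurableT_comp (fine_measurable measurableT)).
apply: measurable_fun_einfs => k; case: unpickle => [[j q]|];
  last exact: measurable_cst.
case: (j == i) => /=; last exact: measurable_cst.
apply: measurable_fun_ifT; [|exact: measurable_cst..].
apply: (measurable_fun_bool true); rewrite setTI.
rewrite (_ : _ @^-1` _ = [set y | digit quarter k y = 1%N]).
  exact: (measurable_digit_set quarter_gt0 k [set 1%N]).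
by apply/seteqP; split=> y /= /eqP.
Qed.

End encoding.

(** * The standard model of an infinite sigma-finite atomless measure *)

Lemma measure_bigcup_infinite d (T : measurableType d) (R : realType)
    (mu : {measure set T -> \bar R}) (F : (set T)^nat) (c : R) : 0 < c ->
  (forall k, measurable (F k)) -> trivIset setT F ->
  (forall k, (c%:E <= mu (F k))%E) -> mu (\bigcup_k F k) = +oo%E.
Proof.
move=> c0 mF tF cF; rewrite measure_semi_bigcup//; last exact: bigcupT_measurable.
apply/eqyP => x x0; pose N := (Num.truncn (x / c)).+1.
apply: (@le_trans _ _ (\sum_(0 <= i < N) mu (F i))%E); last exact: nneseries_lim_ge.
apply: (@le_trans _ _ (\sum_(0 <= i < N) c%:E)%E); last exact: lee_sum.
rewrite sumEFin sumr_const_nat subn0 lee_fin -mulr_natl -ler_pdivrMr// ltW//.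
exact: truncnS_gt.
Qed.

(** For each [k] and [m], only finitely many of the disjoint [D t] meet [F k] in measure above
    [m.+1%:R^-1]; hence all but countably many [t] qualify. *)
Lemma exists_null_member d (T : measurableType d) (R : realType)
    (mu : {measure set T -> \bar R}) (I : pointedType) (D : I -> set T)
    (F : (set T)^nat) :
  ~ countable [set: I] -> (forall t, measurable (D t)) -> trivIset setT D ->
  (forall k, measurable (F k)) -> (forall k, mu (F k) < +oo)%E ->
  exists t, forall k, mu (D t `&` F k) = 0%E.
Proof.
move=> unctI mD tD mF Foo; apply: contrapT => /forallNP big.
apply: unctI.
pose J k m := [set t | (m.+1%:R^-1%:E < mu (D t `&` F k))%E].
have finJ k m : finite_set (J k m).
  apply: contrapT => /infiniteP/ppcard_leP[f].
  have fJ i : J k m (f i) by exact: funS.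
  pose E i := D (f i) `&` F k.
  have mE i : measurable (E i) by exact: measurableI.
  have tE : trivIset setT E.
    move=> i j _ _ [x [[Di _] [Dj _]]].
    have : f i = f j by apply: tD => //; exists x.
    by move/(@inj _ _ _ f); apply; rewrite inE.
  have c0 : 0 < m.+1%:R^-1 :> R by rewrite invr_gt0.
  have := measure_bigcup_infinite c0 mE tE (fun i => ltW (fJ i)).
  apply/eqP; rewrite -ltey; apply: le_lt_trans (Foo k).
  apply: le_measure; rewrite ?inE//; first exact: bigcupT_measurable.
  by move=> x [i _ []].
apply: (@sub_countable _ _ _ (\bigcup_k \bigcup_m J k m)).
  apply: subset_card_le => t _; have /existsNP[k /eqP muk] := big t.
  have fk : mu (D t `&` F k) \is a fin_num.
    rewrite ge0_fin_numE//; apply: le_lt_trans (Foo k).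
    by apply: le_measure; rewrite ?inE//; exact: measurableI.
  have k0 : 0 < fine (mu (D t `&` F k)).
    by rewrite fine_gt0// lt0e muk measure_ge0/= ltey_eq fk.
  exists k => //; exists (Num.truncn (fine (mu (D t `&` F k)))^-1) => //.
  rewrite /J/= -(fineK fk) lte_fin invf_plt ?posrE//.
  exact: truncnS_gt.
apply: bigcup_countable => // k _; apply: bigcup_countable => // m _.
exact: finite_set_countable.
Qed.

Section null_copy.
Context (R : realType).
Local Notation mR := (measurableTypeR R).

Lemma uncountable_real : ~ countable [set: R].
Proof.
move=> /countable_lebesgue_measure0.
rewrite -set_itvNyy lebesgue_measure_itv/= .
by [].
Qed.

Definition slice (s : R) (x : mR) : borel_row R 2 :=
  \row_i (if i == ord0 then s else x).

(** Encoding the plane in the line turns its parallel lines into a continuum of disjoint copies of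
    the line. The shift by 1 places them in the half-line on which [quantile_embedding] holds. *)
Lemma slice_encode_embedding (s : R) :
  borel_embedding (setT : set mR) (`]0, +oo[%classic : set mR)
    (fun x => 1 + encode_row (slice s x)).
Proof.
pose g (y : mR) : mR := @decode_row R 2 (y - 1) ord0 (lift ord0 ord0).
apply: (@borel_embedding_left_inverse _ _ _ _ R _ _ _ g id) => //.
- apply: measurable_funD => //; apply: (measurableT_comp (@measurable_encode_row
  R 2)).
  apply: measurable_fun_row => i.
  rewrite (_ : (fun x => _) = (fun x : mR => if i == ord0 then s else x : mR)).
    by case: (i == ord0); [exact: measurable_cst|exact: measurable_id].
  by apply/funext => x; rewrite mxE.
- apply: (measurableT_comp (@measurable_coord R 2 (lift ord0 ord0))).
  apply: (measurableT_comp (@measurable_decode_row R 2)).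
  exact: measurable_funB.
- by move=> _ [x _ <-] /=; rewrite in_itv/= andbT ltr_wpDr ?encode_row_ge0.
- by move=> x _; rewrite /g addrAC subrr add0r encode_rowK mxE.
Qed.

(* Inside the co-null set [E] there is a closed set [K] of infinite measure;
   the quantile function of Lebesgue measure on [K] embeds a half-line in [K],
   hence a continuum of disjoint copies of the line, one of which is null. *)
Lemma null_copy (E : set mR) : measurable E -> half_lebesgue (~` E) = 0%E ->
  exists P f, [/\ measurable P, P `<=` E, half_lebesgue P = 0%E &
    borel_embedding (setT : set mR) P f].
Proof.
move=> mE E0.
pose D : set mR := ~` E `&` `[0, +oo[%classic.
have mD : measurable D by apply: measurableI => //; exact: measurableC.
have D0 : lebesgue_measure D = 0%E by exact: E0.
(* An open set of finite measure around the null set [D] leaves a closed part of the half-line,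
   inside [E] and of infinite measure. *)
have [|U [oU DU UD]] := lebesgue_regularity_outer mD _ (@ltr01 R).
  by rewrite [X in (X < _)%E]D0 ltry.
have mU : measurable (U : set mR) by exact: open_measurable.
have U1 : (lebesgue_measure U < +oo)%E.
  apply: (@le_lt_trans _ _ (lebesgue_measure (U `\` D) + lebesgue_measure D)%E).
    apply: le_trans (measureU2 _ _ _) => //; last exact: measurableD.
    apply: le_measure; rewrite ?inE//; first by apply: measurableU => //;
      exact: measurableD.
    by move=> x Ux; have [Dx|nDx] := pselect (D x); [right|left].
  by rewrite [X in (_ + X)%E]D0 adde0; apply: lt_trans UD _; rewrite ltry.
pose K : set R := `[0, +oo[%classic `\` U.
have mK : measurable (K : set mR) by exact: measurableD.
have cK : closed K by apply: closedI; [exact: interval_closed|exact: open_closedC].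
have KE : K `<=` E.
  by move=> x [x0 nU]; apply: contrapT => nE; apply: nU; apply: DU; split.
pose nu : {measure set mR -> \bar R} := mrestr (@lebesgue_measure R) mK.
have nu_fin x : (nu `]-oo, x]%classic < +oo)%E.
  apply: (@le_lt_trans _ _ (half_lebesgue `]-oo, x]%classic)).
    apply: le_measure; rewrite ?inE//; try exact: measurableI.
    by apply: setIS => z [].
  by rewrite half_lebesgue_ray ltry.
have nu_atomless x : nu [set x] = 0%E.
  apply: (subset_measure0 _ _ _ (lebesgue_measure_set1 x)) => //;
    first exact: measurableI.
have nu_nonpos : nu `]-oo, 0]%classic = 0%E.
  apply: (subset_measure0 _ _ _ (lebesgue_measure_set1 0)) => //;
    first exact: measurableI.
  move=> x [] /=; rewrite in_itv/= => x0 [] /=; rewrite in_itv/= andbT => x0' _.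
  by apply/eqP; rewrite eq_le x0 x0'.
have nu_infinite : nu setT = +oo%E.
  rewrite /nu/= /mrestr setTI.
  have : (+oo <= lebesgue_measure K + lebesgue_measure U)%E.
    have <- : lebesgue_measure (`[0, +oo[%classic : set mR) = +oo%E.
      by rewrite lebesgue_measure_itv/= ltry.
    apply: le_trans (measureU2 _ _ _) => //; apply: le_measure; rewrite ?inE//.
      exact: measurableU.
    by move=> x x0; have [Ux|nUx] := pselect (U x); [right|left].
  by rewrite leye_eq => /eqP; move: U1; case: (lebesgue_measure U) => // u;
    case: (lebesgue_measure K).
have nuK : nu (~` K) = 0%E.
  by rewrite /nu/= /mrestr setICl measure0.
have eq := quantile_embedding nu_fin nu_atomless nu_nonpos nu_infinite.
have qK := quantile_closed nu_fin nu_atomless nu_nonpos nu_infinite cK nuK.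
pose c s x := quantile nu (1 + encode_row (slice s x)).
have ec s : borel_embedding (setT : set mR) (setT : set mR) (c s).
  exact: borel_embedding_comp (slice_encode_embedding s) eq.
have mc s : measurable (range (c s) : set mR).
  exact: borel_embedding_measurable (ec s).
have tc : trivIset setT (fun s => range (c s)).
  move=> s s' _ _ [y [[x _ <-] [x' _]]].
  have [qi _ _ _] := eq; move=> /qi; rewrite !inE/= !in_itv/= !andbT.
  rewrite !ltr_wpDr ?encode_row_ge0// => /(_ erefl erefl)/addrI.
  by move=> /(can_inj (@encode_rowK R 2))/rowP/(_ ord0); rewrite !mxE/=.
have [s sP] := @exists_null_member _ _ _ (@half_lebesgue R) R _
  (fun k => `]-oo, k%:R]%classic) uncountable_real mc tc (fun=> measurable_itv _)
  (fun k => eq_ind_r (fun x => x < +oo)%E (ltry _) (half_lebesgue_ray k%:R)).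
exists (range (c s)), (c s); split.
- exact: mc.
- by move=> _ [x _ <-]; apply/KE/qK; rewrite addr_ge0 ?encode_row_ge0.
- have <- : half_lebesgue (\bigcup_k (range (c s) `&` `]-oo, k%:R]%classic)) = 0%E.
    by apply: measure_bigcup_null => // k; exact: measurableI.
  rewrite -setI_bigcupr; congr (half_lebesgue _); apply/esym/setIidl => x _.
  exists (Num.truncn `|x|).+1 => //=; rewrite in_itv/=.
  by rewrite (le_trans (ler_norm x))// ltW// truncnS_gt.
- exact: borel_embedding_sub measurableT _ _ (ec s).
Qed.

End null_copy.

Section standard_model.
Context (R : realType) (n : nat).
Local Notation mR := (measurableTypeR R).
Local Notation T := (borel_row R n).
Variables (mu : {measure set T -> \bar R}) (A_ : (set T)^nat).
Hypothesis mu_atomless : forall x, mu [set x] = 0%E.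
Hypothesis mA_ : forall k, measurable (A_ k).
Hypothesis A_fin : forall k, (mu (A_ k) < +oo)%E.
Let A := \bigcup_k A_ k.
Hypothesis A_infinite : mu A = +oo%E.

Let mA : measurable A. Proof. exact: bigcupT_measurable. Qed.

Definition first_index (z : T) : nat :=
  if pselect (exists k, `[< A_ k z >]) is left h then ex_minn h else 0%N.

Let first_indexP z : A z ->
  A_ (first_index z) z /\ forall j, A_ j z -> (first_index z <= j)%N.
Proof.
move=> [k _ Ak]; rewrite /first_index; case: pselect => [h|[]]; last first.
  by exists k; apply/asboolP.
by case: ex_minnP => j /asboolP Aj jmin; split=> // i Ai; apply: jmin; apply/asboolP.
Qed.

Let first_index0 z : ~ A z -> first_index z = 0%N.
Proof.
move=> nA; rewrite /first_index; case: pselect => // h.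
by have [k /asboolP Ak] := h; case: nA; exists k.
Qed.

Let measurable_first_index :
  measurable_fun setT (fun z => (first_index z)%:R : mR).
Proof.
have mfib k : measurable [set z | first_index z = k].
  rewrite (_ : [set _ | _] = (A `&` (A_ k `&` \bigcap_(j in `I_k) ~` A_ j))
      `|` (~` A `&` [set _ | k = 0%N])).
    apply: measurableU; last first.
      apply: measurableI; first exact: measurableC.
      have [->|k0] := eqVneq k 0%N.
        by rewrite (_ : [set _ | _] = setT)//; apply/seteqP; split.
      rewrite (_ : [set _ | _] = set0)//; apply/seteqP; split=> // z /= k0'.
      by rewrite k0' eqxx in k0.
    apply: measurableI => //; apply: measurableI => //.
    by apply: fin_bigcap_measurable => // j _; exact: measurableC.
  apply/seteqP; split=> z /=.
    move=> <-; have [Az|nAz] := pselect (A z); last by right; rewrite first_index0.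
    have [h hmin] := first_indexP Az; left; split=> //; split=> // j /= jk /hmin.
    by rewrite leqNgt jk.
  move=> [[Az [Ak kmin]]|[nAz ->]]; last exact: first_index0.
  have [h hmin] := first_indexP Az; apply/eqP; rewrite eqn_leq hmin//=.
  by rewrite leqNgt; apply/negP => /kmin.
move=> _ Y mY; rewrite setTI.
rewrite (_ : _ @^-1` _ = \bigcup_(k in [set k | Y k%:R]) [set z | first_index z =
  k]).
  exact: bigcup_measurable.
by apply/seteqP; split=> z /=; [move=> Yz; exists (first_index z)|move=> [k Yk ->]].
Qed.

(** [encode_row] lies in [0, 1[, so the integer part records the first [A_ k] containing the point.
    A ray then meets the image of only finitely many of these layers, which makes the pushforward of
    [mu] on [A] finite on rays. *)
Let enc (z : T) : mR := encode_row z + (first_index z)%:R.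
(** The division by 1 gives the form of [measurable_truncn_div]. *)
Let dec (y : R) : T := @decode_row R n (y - (Num.truncn (y / 1))%:R).

Let measurable_enc : measurable_fun setT enc.
Proof. by apply: measurable_funD => //; exact: measurable_encode_row. Qed.

Let encK : cancel enc dec.
Proof.
move=> z; rewrite /dec (_ : Num.truncn _ = first_index z);
  first by rewrite addrK encode_rowK.
apply: truncn_def; rewrite divr1 /enc lerDr encode_row_ge0/= -natr1 addrC ltrD2l.
exact: encode_row_lt1.
Qed.

Let measurable_dec : measurable_fun setT dec.
Proof.
apply: (measurableT_comp (@measurable_decode_row R n)); apply: measurable_funB => //.
exact: measurable_truncn_div.
Qed.

Let enc_inj : injective enc. Proof. exact: can_inj encK. Qed.

Let enc_ge z : (first_index z)%:R <= enc z.
Proof. by rewrite /enc lerDr encode_row_ge0. Qed.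

Let enc_embedding : borel_embedding setT setT enc.
Proof.
by apply: (@borel_embedding_left_inverse _ _ _ _ R _ _ _ dec id) => // z _;
  exact: encK.
Qed.

Let nu_ex : exists nu : {measure set mR -> \bar R},
  forall B, nu B = mu (enc @^-1` B `&` A).
Proof.
have [nu nuE] := pushforward_measure (mrestr mu mA) measurable_enc.
by exists nu.
Qed.

Let mu_point (B : set T) x : B `<=` [set x] -> mu B = 0%E.
Proof. by move=> /subset_set1[|] ->; rewrite ?measure0. Qed.

Let embedding_line : exists2 A0 : set T, [/\ measurable A0, A0 `<=` A &
    exists f, measure_embedding mu (@half_lebesgue R) A0 `[0, +oo[%classic f /\
    half_lebesgue (~` (f @` A0)) = 0%E] & mu (A `\` A0) = 0%E.
Proof.
have [nu nuE] := nu_ex.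
have nu_fin x : (nu `]-oo, x]%classic < +oo)%E.
  rewrite nuE; set N := (Num.truncn `|x|).+1.
  apply: (@le_lt_trans _ _ (mu (\big[setU/set0]_(k < N) A_ k))).
    apply: le_measure; rewrite ?inE.
    - by apply: measurableI => //; rewrite -[_ @^-1` _]setTI; exact: measurable_enc.
    - by apply: bigsetU_measurable => k _; exact: mA_.
    move=> z [/= + Az]; rewrite in_itv/= => zx; rewrite -bigcup_mkord.
    exists (first_index z); last exact: (first_indexP Az).1.
    rewrite /= -(ltr_nat R); apply: le_lt_trans (truncnS_gt `|x|).
    by apply: le_trans (enc_ge z) (le_trans zx _); exact: ler_norm.
  apply: (@le_lt_trans _ _ (\sum_(k < N) mu (A_ k))%E).
    by apply: Boole_inequality => k _; exact: mA_.
  by apply: lte_sum_pinfty => k _; exact: A_fin.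
have nu_atomless x : nu [set x] = 0%E.
  rewrite nuE; apply: (@mu_point _ (dec x)) => z [/= <- _]; by rewrite encK.
have nu_nonpos : nu `]-oo, 0]%classic = 0%E.
  rewrite nuE; apply: (@mu_point _ (dec 0)) => z [/=]; rewrite in_itv/= => z0 _.
  (* [enc] is nonnegative and injective, so the ray up to 0 pulls back to at most one point. *)
  have /eqP <- : enc z == 0.
    by rewrite eq_le z0 /enc addr_ge0 ?encode_row_ge0.
  by rewrite encK.
have nu_infinite : nu setT = +oo%E by rewrite nuE preimage_setT setTI.
have eF := cdf_of_embedding nu_fin nu_atomless nu_nonpos nu_infinite.
have mreg := measurable_cdf_regular nu_fin nu_atomless nu_nonpos nu_infinite.
pose A0 := A `&` enc @^-1` cdf_regular nu.
have mA0 : measurable A0.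
  by apply: measurableI => //; rewrite -[_ @^-1` _]setTI; exact: measurable_enc.
have A0A : A0 `<=` A by move=> ? [].
have A0null : mu (A `\` A0) = 0%E.
  have := cdf_regular_conull nu_fin nu_atomless nu_nonpos nu_infinite.
  rewrite nuE => <-; congr (mu _); apply/seteqP; split=> z /=.
    by move=> [Az nA0]; split=> // rz; apply: nA0.
  by move=> [nr Az]; split=> // -[].
have eenc : measure_embedding mu nu A0 (cdf_regular nu) enc.
  split; first by apply: borel_embedding_sub enc_embedding => // _ [z [_ rz] <-].
  move=> S mS SA0; rewrite nuE; congr (mu _); apply/seteqP; split=> z /=.
    by move=> [[z' Sz' /enc_inj <-]].
  by move=> Sz; split; [exists z|exact: A0A (SA0 _ Sz)].
have ef := measure_embedding_comp eenc eF.
exists A0 => //; split=> //; exists (cdf_of nu \o enc); split=> //.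
have mfA0 : measurable ((cdf_of nu \o enc) @` A0).
  exact: borel_embedding_measurable ef.1.
rewrite -(measure_preimage_cdf_of nu_fin nu_atomless nu_nonpos nu_infinite);
  last first.
  exact: measurableC.
rewrite nuE; apply: (subset_measure0 _ _ _ A0null).
- apply: measurableI => //; rewrite -[_ @^-1` _]setTI; apply: measurable_enc => //.
  rewrite -[_ @^-1` _]setTI; apply: (measurable_cdf_of nu_fin) => //.
  exact: measurableC.
- exact: measurableD.
- by move=> z /= [nz Az]; split=> // A0z; apply: nz; exists z.
Qed.

Lemma standard_iso : exists f, measure_iso mu (@half_lebesgue R) A setT f.
Proof.
have [A0 [mA0 A0A [f [ef fA0]]] AA0] := embedding_line.
have mAA0 : measurable (A `\` A0) by exact: measurableD.
have mE : measurable (f @` A0) by exact: borel_embedding_measurable ef.1.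
have toZ : exists g, measure_embedding mu (@half_lebesgue R) A setT g.
  have eN : borel_embedding (A `\` A0) (`]-oo, 0[%classic : set mR) (fun z =>
    encode_row z - 1).
    apply: (@borel_embedding_left_inverse _ _ _ _ R _ _ _ (fun y : mR =>
      @decode_row R n (y + 1)) id) => //.
    - by apply: measurable_funB => //; exact: measurable_encode_row.
    - apply: (measurableT_comp (@measurable_decode_row R n)); exact: measurable_funD.
    - by move=> _ [z _ <-]; rewrite /= in_itv/= subr_lt0 encode_row_lt1.
    - by move=> z _; rewrite subrK encode_rowK.
  have N0 : half_lebesgue (`]-oo, 0[%classic : set mR) = 0%E.
    have := half_lebesgue_ray (0 : R); rewrite maxxx => r0.
    by apply: (subset_measure0 _ _ _ r0) => //; apply: subitvPr; rewrite bnd_simp.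
  have := measure_embedding_glue mA0 mAA0 _ _ ef (null_embedding mAA0 _ AA0 N0 eN).
  rewrite setDUK// => e; eexists; split; last first.
    apply: (e _ _ _).2 => //.
    + by rewrite setDE setICA setICr setI0.
    + by apply/seteqP; split=> // x []/=; rewrite !in_itv/= andbT leNgt => /negP.
  apply: borel_embedding_sub mA (@subset_refl _ _) _ (e _ _ _).1 => //.
  + by rewrite setDE setICA setICr setI0.
  + by apply/seteqP; split=> // x []/=; rewrite !in_itv/= andbT leNgt => /negP.
have [P [c [mP PE P0 ec]]] := null_copy mE fA0.
have [f' [ef' _] _] := measure_iso_inverse mA0 (measure_embedding_iso ef).
have mEP : measurable (f @` A0 `\` P) by exact: measurableD.
have EPC0 : half_lebesgue (~` (f @` A0 `\` P)) = 0%E.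
  rewrite setCD; apply/eqP; rewrite eq_le measure_ge0 andbT.
  apply: le_trans (measureU2 _ _ _) _ => //; first exact: measurableC.
  by rewrite [X in (X + _)%E]fA0 [X in (_ + X)%E]P0 adde0.
have e1 : measure_embedding (@half_lebesgue R) (@half_lebesgue R)
    (f @` A0 `\` P) (f @` A0 `\` P) id.
  split; last by move=> S _ _; rewrite image_id.
  apply: (@borel_embedding_left_inverse _ _ _ _ R _ _ _ id id) => //.
  by rewrite image_id.
have e2 : measure_embedding (@half_lebesgue R) (@half_lebesgue R)
    (~` (f @` A0 `\` P)) P c.
  apply: null_embedding => //; first exact: measurableC.
  apply: (borel_embedding_sub _ _ _ ec) => //; first exact: measurableC.
  by have [_ cP _ _] := ec; move=> _ [x _ <-]; apply: cP; exists x.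
have := measure_embedding_glue mEP (measurableC mEP) (setICr _) _ e1 e2.
rewrite setUCr => e3; have [g eg] := toZ.
have EPE : (f @` A0 `\` P) `|` P `<=` f @` A0.
  by move=> y [[]|/PE].
have eg' := measure_embedding_codomain A0A (measure_embedding_comp
  (measure_embedding_codomain EPE (e3 _)) ef').
apply: measure_schroeder_bernstein eg (eg' _) => //.
by rewrite setDE -setIA setICl setI0.
Qed.

End standard_model.

(** * Hausdorff measure *)

Section hausdorff_facts.
Context (R : realType) (n : nat).
Local Notation T := (borel_row R n).
Implicit Types (d : R) (A : set 'rV[R]_n).

Definition borel_hausdorff d : set T -> \bar R := @hausdorff R n d.

Let borel_hausdorff0 d : borel_hausdorff d set0 = 0%E.
Proof. exact: hausdorff0. Qed.

Let borel_hausdorff_ge0 d A : (0 <= borel_hausdorff d A)%E.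
Proof. exact: hausdorff_ge0. Qed.

Let borel_hausdorff_sigma_additive d : semi_sigma_additive (borel_hausdorff d).
Proof.
move=> A mA tA _.
have cA k : (hausdorff d).-caratheodory (A k) by exact: borel_caratheodory (mA k).
apply: (@caratheodory_measure_sigma_additive _ _ (hausdorff d)) => //.
exact: caratheodory_measurable_bigcup.
Qed.

HB.instance Definition _ d := isMeasure.Build _ _ _ (borel_hausdorff d)
  (borel_hausdorff0 d) (borel_hausdorff_ge0 d) (@borel_hausdorff_sigma_additive d).

Lemma euclidean_dist_le (c : R) (x y : 'rV[R]_n) : 0 <= c ->
  (forall i, `|x ord0 i - y ord0 i| <= c) ->
  euclidean_dist x y <= Num.sqrt n%:R * c.
Proof.
move=> c0 xyc; rewrite /euclidean_dist -[X in _ * X](ger0_norm c0) -sqrtr_sqr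
  -sqrtrM ?ler0n//.
rewrite ler_wsqrtr// (@le_trans _ _ (\sum_(i < n) c ^+ 2))//.
  apply: ler_sum => i _; rewrite -real_normK ?num_real//.
  by rewrite lerXn2r ?nnegrE.
by rewrite sumr_const card_ord mulr_natl.
Qed.

Lemma coord_le_euclidean_dist (x y : 'rV[R]_n) i :
  `|x ord0 i - y ord0 i| <= euclidean_dist x y.
Proof.
rewrite /euclidean_dist -sqrtr_sqr ler_wsqrtr// (bigD1 i)//= lerDl.
by rewrite sumr_ge0// => k _; exact: sqr_ge0.
Qed.

Lemma diameter_le (c : R) A : 0 <= c ->
  (forall x y, A x -> A y -> euclidean_dist x y <= c) -> (diameter A <= c%:E)%E.
Proof.
move=> c0 Ac; apply: ge_ereal_sup => _ [->|[x Ax [y Ay <-]]]; rewrite lee_fin//.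
exact: Ac.
Qed.

Lemma hausdorff_gaugeE d A : 0 < d -> hausdorff_gauge d A = (diameter A `^ d)%E.
Proof.
move=> d0; rewrite /hausdorff_gauge; case: eqP => // ->.
by rewrite diameter0 poweR0r// gt_eqF.
Qed.

Lemma hausdorff_gauge_le d (c : R) A : 0 < d -> (diameter A <= c%:E)%E ->
  (hausdorff_gauge d A <= (c `^ d)%:E)%E.
Proof.
move=> d0 Ac; rewrite hausdorff_gaugeE// -poweR_EFin.
have A0 := diameter_ge0 A; have c0 := le_trans A0 Ac.
by apply: gt0_ler_poweR => //; rewrite ?ltW// in_itv/= ?A0 ?c0 leey.
Qed.

Lemma hausdorff_point d (x : 'rV[R]_n) : 0 < d -> hausdorff d [set x] = 0%E.
Proof.
move=> d0; apply/eqP; rewrite eq_le hausdorff_ge0 andbT.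
apply: ge_ereal_sup => _ [e /= e0 <-].
have x0 : (diameter [set x] <= 0%:E)%E.
  apply: diameter_le => // _ _ -> ->; rewrite /euclidean_dist.
  by rewrite big1 ?sqrtr0// => i _; rewrite subrr expr0n.
apply: ereal_inf_lbound; exists (fun=> [set x]).
  split; first by move=> y ->; exists 0%N.
  by move=> _; apply: le_trans x0 _; rewrite lee_fin ltW.
apply: eseries0 => k _ _; apply/eqP; rewrite eq_le hausdorff_gauge_ge0 andbT.
by have := hausdorff_gauge_le d0 x0; rewrite powR0// gt_eqF.
Qed.

Lemma hausdorff_delta_finite_cover d e (W : finType) (cell : W -> set 'rV[R]_n) A :
  A `<=` \bigcup_w cell w -> 0 < e -> (forall w, diameter (cell w) <= e%:E)%E ->
  (hausdorff_delta d e A <= \sum_(w : W) hausdorff_gauge d (cell w))%E.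
Proof.
move=> AW e0 We.
pose U k := if insub k is Some j then cell (@enum_val W (mem W) j) else set0.
have UE (j : 'I_#|W|) : U j = cell (enum_val j) by rewrite /U valK.
have U0 k : (#|W| <= k)%N -> U k = set0.
  by move=> Wk; rewrite /U insubF// ltnNge Wk.
apply: (@le_trans _ _ (\sum_(k <oo) hausdorff_gauge d (U k))%E).
  apply: ereal_inf_lbound; exists U => //; split.
    move=> x /AW[w _ wx]; exists (enum_rank w) => //.
    by rewrite UE enum_rankK.
  move=> k; rewrite /U; case: insub => [j|]; first exact: We.
  by rewrite diameter0 lee_fin ltW.
rewrite (nneseries_split _ #|W|); last by move=> *; exact: hausdorff_gauge_ge0.
rewrite add0n [X in (_ + X)%E]eseries0 ?adde0; last first.
  by move=> k Wk _; rewrite U0// hausdorff_gauge0.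
rewrite big_mkord (eq_bigr (fun j => hausdorff_gauge d (cell (enum_val j))));
  last first.
  by move=> j _; rewrite UE.
by rewrite -(big_enum_val (fun w => hausdorff_gauge d (cell w))).
Qed.

(* Mass distribution: the inverse of [g] being [d]-Hoelder, pulling a cover of
   the image back along [g] covers [0, 1[ by intervals. *)
Lemma hausdorff_image_ge d (c : R) (g : R -> 'rV[R]_n) : 0 < d -> 0 < c ->
  (forall x y, 0 <= x < 1 -> 0 <= y < 1 ->
    `|x - y| <= c * euclidean_dist (g x) (g y) `^ d) ->
  (((2 * c)^-1)%:E <= hausdorff d (g @` `[0%R, 1%R[))%E.
Proof.
move=> d0 c0 gc.
apply: (@le_trans _ _ (hausdorff_delta d 1 (g @` `[0%R, 1%R[))); last first.
  by apply: ereal_sup_ubound; exists 1 => //=.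
apply: le_ereal_inf_tmp => _ [U [gU U1] <-].
have Ufin k : diameter (U k) \is a fin_num.
  rewrite ge0_fin_numE ?diameter_ge0//; apply: le_lt_trans (U1 k) _; exact: ltry.
pose L k : R := c * fine (diameter (U k)) `^ d.
have L0 k : 0 <= L k by rewrite mulr_ge0 ?powR_ge0// ltW.
have LE k : hausdorff_gauge d (U k) = (c^-1 * L k)%:E.
  by rewrite hausdorff_gaugeE// -(fineK (Ufin k)) poweR_EFin/= /L mulKf// gt_eqF.
(* Any one parameter sent into [U k] can be the centre: by the Hoelder bound all the others are
   within [L k] of it. *)
pose I k : set (measurableTypeR R) :=
  if pselect (exists x, 0 <= x < 1 /\ U k (g x)) is left h
  then `[projT1 (cid h) - L k, projT1 (cid h) + L k]%classic else set0.
have IU : `[0%R, 1%R[%classic `<=` \bigcup_k I k.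
  move=> x; rewrite /= in_itv/= => x01.
  have [k _ Uk] : (\bigcup_k U k) (g x) by apply: gU; exists x.
  exists k => //; rewrite /I; case: pselect => [h|[]]; last by exists x.
  case: cid => y [y01 Uy] /=; rewrite in_itv/= -ler_distl.
  apply: le_trans (gc _ _ _ _) _ => //; rewrite /L ler_pM2l//.
  apply: ge0_ler_powR; rewrite ?nnegrE ?fine_ge0 ?diameter_ge0 ?sqrtr_ge0//;
    first exact: ltW.
  by rewrite -lee_fin fineK//; exact: dist_le_diameter.
have Il k : (lebesgue_measure (I k) <= (2 * c)%:E * hausdorff_gauge d (U k))%E.
  rewrite LE -EFinM mulrA mulfK ?gt_eqF// /I; case: pselect => [h|_]; last first.
    by rewrite measure0 lee_fin mulr_ge0.
  rewrite lebesgue_measure_itv/=; case: ifPn => _; last by rewrite lee_fin mulr_ge0.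
  by rewrite -EFinB lee_fin; lra.
have mI k : measurable (I k) by rewrite /I; case: pselect.
have : (1 <= (2 * c)%:E * \sum_(k <oo) hausdorff_gauge d (U k))%E.
  have <- : lebesgue_measure (`[0%R, 1%R[%classic : set (measurableTypeR R)) = 1%E.
    by rewrite lebesgue_measure_itv/= lte_fin ltr01 oppr0 adde0.
  apply: (@le_trans _ _ (lebesgue_measure (\bigcup_k I k))).
    by apply: le_measure; rewrite ?inE//; exact: bigcupT_measurable.
  apply: le_trans (generalized_Boole_inequality _ _ _) _ => //.
    exact: bigcupT_measurable.
  rewrite -nneseriesZl; last by move=> k _; exact: hausdorff_gauge_ge0.
  by apply: lee_nneseries => [k _ _|k _]; [exact: measure_ge0|exact: Il].
by rewrite -lee_pdivrMl ?mulr_gt0// mule1.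
Qed.

End hausdorff_facts.

(** * Disjoint Cantor sets of finite positive measure *)

Section greedy_digits.
Context (R : realType) (r : R).
Hypothesis r_gt0 : 0 < r.

Lemma residue_itv k y : 0 <= y < 1 -> 0 <= residue r k y < 1.
Proof.
move=> y01; elim: k => [//|k /andP[ih _]] /=.
have := truncn_itv (divr_ge0 ih (ltW r_gt0)); rewrite -natr1.
by rewrite subr_ge0 ltrBlDl => /andP[-> ->].
Qed.

Lemma residueE k y : residue r k y = r * ((digit r k y)%:R + residue r k.+1 y).
Proof. by rewrite /= /digit addrCA subrr addr0 mulrC divfK// gt_eqF. Qed.

Lemma residue_common_digits N y y' : (forall k, (k < N)%N ->
  digit r k y = digit r k y') ->
  y - y' = r ^+ N * (residue r N y - residue r N y').
Proof.
elim: N => [|N ih] yy'; first by rewrite expr0 mul1r.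
rewrite ih; last by move=> k kN; apply: yy'; exact: ltnW.
by rewrite !(residueE N) yy'// -mulrBr opprD addrACA subrr add0r exprSr mulrA.
Qed.

Lemma common_digits_le N y y' : 0 <= y < 1 -> 0 <= y' < 1 ->
  (forall k, (k < N)%N -> digit r k y = digit r k y') -> `|y - y'| <= r ^+ N.
Proof.
move=> y01 y01' /residue_common_digits ->.
rewrite normrM ger0_norm ?exprn_ge0 ?(ltW r_gt0)// ler_piMr ?exprn_ge0 ?(ltW
  r_gt0)//.
have := residue_itv N y01; have := residue_itv N y01'.
by move=> /andP[? ?] /andP[? ?]; rewrite ler_norml; apply/andP; split; lra.
Qed.

(* Digits of the same parity that differ do so by at least 2. *)
Lemma first_digit_ge N y y' : 0 <= y < 1 -> 0 <= y' < 1 ->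
  (forall k, (k < N)%N -> digit r k y = digit r k y') ->
  odd (digit r N y) = odd (digit r N y') -> digit r N y != digit r N y' ->
  r ^+ N.+1 <= `|y - y'|.
Proof.
move=> y01 y01' /residue_common_digits -> odd_eq neq.
rewrite normrM ger0_norm ?exprn_ge0 ?(ltW r_gt0)// exprSr ler_pM2l ?exprn_gt0//.
rewrite !(residueE N) -mulrBr normrM gtr0_norm// ler_peMr ?(ltW r_gt0)//.
have := residue_itv N.+1 y01; have := residue_itv N.+1 y01'.
have [k kE] : exists2 k : int, k != 0 & (digit r N y)%:R - (digit r N y')%:R = 2
  * k%:~R :> R.
  exists ((digit r N y)./2%:Z - (digit r N y')./2%:Z).
    apply: contra neq; rewrite subr_eq0 => /eqP[e].
    by rewrite -(odd_double_half (digit r N y)) -(odd_double_half (digit r N y'))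
      odd_eq e.
  rewrite -{1}(odd_double_half (digit r N y)) -{1}(odd_double_half (digit r N
    y')) odd_eq.
  by rewrite !natrD -!muln2 !natrM rmorphB/=; ring.
move: (residue r N.+1 y) (residue r N.+1 y') => u u' e /andP[u0 u1] /andP[v0 v1].
rewrite opprD addrACA e.
have : 1 <= (k%:~R : R) \/ (k%:~R : R) <= -1.
  move: kE; case: k e => [[|k]|k] e // _; [left|right].
    by rewrite -[1](mulr1z 1) ler_int.
  by rewrite NegzE mulrNz lerN2 -[1](mulr1z 1) ler_int.
move=> [k1|k1].
  by apply: (le_trans _ (ler_norm _)); lra.
by rewrite -normrN; apply: (le_trans _ (ler_norm _)); lra.
Qed.

End greedy_digits.

Section cantor_sets.
Context (R : realType) (n m : nat) (d : R).
Hypotheses (n_gt0 : (0 < n)%N) (m_gt1 : (1 < m)%N) (d_gt0 : 0 < d).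
Variable r : R.
Hypotheses (r_gt0 : 0 < r) (mr_lt1 : (2 * m)%N%:R * r < 1).
Hypothesis r_dim : r `^ d = m%:R^-1 ^+ n.
Local Notation T := (borel_row R n).
Implicit Types (t : nat -> bool).

Let m_gt0 : (0 < m)%N. Proof. exact: ltnW. Qed.


(* All digits at position [k] have the parity [t k], so that different [t] give
   disjoint sets and different digits are at least 2 apart. *)
Definition cantor_set t : set T := [set z | forall i, 0 <= z ord0 i < 1 /\
  forall k, (digit r k (z ord0 i) < 2 * m)%N /\ odd (digit r k (z ord0 i)) = t k].

Lemma trivIset_cantor_set : trivIset setT cantor_set.
Proof.
move=> t t' _ _ [z [zt zt']]; apply/funext => k.
have [_ /(_ k)[_ <-]] := zt (Ordinal n_gt0).
by have [_ /(_ k)[_ <-]] := zt' (Ordinal n_gt0).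
Qed.

Lemma measurable_cantor_set t : measurable (cantor_set t).
Proof.
pose D k : set nat := [set j | (j < 2 * m)%N /\ odd j = t k].
rewrite (_ : cantor_set t = \bigcap_(i in [set: 'I_n]) ((fun z : T => z ord0 i) @^-1`
   (`[0, 1[%classic `&` \bigcap_k [set y | D k (digit r k y)]))); last first.
  apply/seteqP; split=> [z zt i _|z zt i].
    by have [z01 zd] := zt i; split=> /=; [rewrite in_itv/=|move=> k _; exact: zd].
  have [/= z01 zd] := zt i Logic.I; move: z01; rewrite in_itv/= => z01.
  by split=> // k; exact: zd.
apply: fin_bigcap_measurable => // i _.
rewrite -[_ @^-1` _]setTI; apply: measurable_coord => //.
apply: measurableI; first exact: measurable_itv.
by apply: bigcapT_measurable => k; exact: measurable_digit_set.
Qed.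

Lemma cantor_set_finite t : (hausdorff d (cantor_set t) < +oo)%E.
Proof.
pose c : R := Num.sqrt n%:R; have c0 : 0 <= c by exact: sqrtr_ge0.
apply: (@le_lt_trans _ _ (c `^ d)%:E); last exact: ltry.
apply: ge_ereal_sup => _ [e /= e0 <-].
have r1 : `|r| < 1.
  rewrite gtr0_norm//; apply: le_lt_trans mr_lt1.
  by rewrite -[leLHS]mul1r ler_pM2r// ler1n muln_gt0.
have [N cN] : exists N, c * r ^+ N <= e.
  have : c * r ^+ N @[N --> \oo] --> c * 0 by apply: cvgMr; exact: cvg_expr.
  rewrite mulr0 => /cvgrPdist_le/(_ _ e0)[N _ /(_ N (leqnn N))].
  rewrite sub0r normrN => h; exists N; exact: le_trans (ler_norm _) h.
(* Since the parity of each digit is prescribed, a cell is given by the halves of its first [N]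
   digits in each coordinate. *)
pose W := {ffun 'I_N * 'I_n -> 'I_m}.
pose cell (w : W) : set 'rV[R]_n := [set z | forall i, 0 <= z ord0 i < 1 /\
  forall k : 'I_N, digit r k (z ord0 i) = (2 * w (k, i) + t k)%N].
have cellD w : (diameter (cell w) <= (c * r ^+ N)%:E)%E.
  have rN0 : 0 <= r ^+ N by rewrite exprn_ge0// ltW.
  apply: diameter_le; first exact: mulr_ge0.
  move=> x y xw yw; apply: euclidean_dist_le => // i.
  have [x01 xd] := xw i; have [y01 yd] := yw i.
  apply: common_digits_le => // k kN.
  by rewrite (xd (Ordinal kN)) (yd (Ordinal kN)).
apply: le_trans (hausdorff_delta_finite_cover d (cell := cell) _ e0 _) _.
- move=> z zt.
  have h2 (p : 'I_N * 'I_n) : ((digit r p.1 (z ord0 p.2))./2 < m)%N.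
    by have [_ /(_ p.1)[+ _]] := zt p.2; rewrite mul2n -ltn_half_double.
  exists [ffun p => Ordinal (h2 p)] => // i; have [z01 zd] := zt i.
  split=> // k; rewrite ffunE/= -[LHS]odd_double_half (zd k).2 addnC mul2n.
  by [].
- by move=> w; apply: le_trans (cellD w) _; rewrite lee_fin.
apply: (@le_trans _ _ (\sum_(w : W) ((c * r ^+ N) `^ d)%:E)%E).
  by apply: lee_sum => w _; exact: hausdorff_gauge_le.
rewrite sumEFin lee_fin sumr_const powRM// ?exprn_ge0 ?(ltW r_gt0)//.
rewrite -powR_mulrn ?(ltW r_gt0)// -powRrM [_%:R * d]mulrC powRrM powR_mulrn
  ?powR_ge0//.
rewrite r_dim card_ffun card_prod !card_ord -[leLHS]mulr_natr.
rewrite -mulrA -[leRHS]mulr1.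
rewrite ler_wpM2l ?powR_ge0// -exprM natrX mulnC -exprMn mulVf ?expr1n//.
by rewrite pnatr_eq0 -lt0n.
Qed.

Let base_digit (x : R) j : nat := digit m%:R^-1 j x.

Let base_digit_lt x j : 0 <= x < 1 -> (base_digit x j < m)%N.
Proof.
move=> x01; rewrite /base_digit /digit -(ltr_nat R).
have m0 : 0 < m%:R^-1 :> R by rewrite invr_gt0 ltr0n.
have /andP[u0 u1] := residue_itv m0 j x01.
have /andP[h _] := truncn_itv (divr_ge0 u0 (ltW m0)).
apply: le_lt_trans h _; rewrite invrK.
by rewrite -[ltRHS]mul1r ltr_pM2r// ltr0n.
Qed.

(** The base-[m] digits of [x] are dealt out in turn to the [n] coordinates, so that [N] levels of
    the Cantor set use [n * N] digits of [x]. The cap at [m.-1] changes nothing on [0, 1[ and bounds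
    the digits for every other [x]. *)
Let point_digit t x (i : 'I_n) k : nat := (2 * minn m.-1 (base_digit x (n * k +
  i)) + t k)%N.

Let point_digit_le t x i k : (point_digit t x i k <= (2 * m).-1)%N.
Proof.
have := geq_minl m.-1 (base_digit x (n * k + i)).
rewrite /point_digit; move: (minn _ _) => a am.
by case: (t k) => /=; lia.
Qed.

Let point t (x : R) : 'rV[R]_n := \row_i expansion r (point_digit t x i).

Let mr_lt1' : (2 * m).-1.+1%:R * r < 1.
Proof. by rewrite prednK// muln_gt0. Qed.

Let point_itv t x i : 0 <= point t x ord0 i < 1.
Proof.
rewrite mxE (expansion_ge0 r_gt0 mr_lt1' (point_digit_le t x i))/=.
exact: (expansion_lt1 r_gt0 mr_lt1').
Qed.

Let digit_point t x i k : digit r k (point t x ord0 i) = point_digit t x i k.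
Proof. by rewrite mxE (digit_expansion r_gt0 mr_lt1'). Qed.

Let point_cantor t x : cantor_set t (point t x).
Proof.
move=> i; split=> // k; rewrite digit_point; split.
  by have := point_digit_le t x i k; have := n_gt0; lia.
by rewrite /point_digit oddD mul2n odd_double; case: (t k).
Qed.

Let point_dist t x x' : 0 <= x < 1 -> 0 <= x' < 1 ->
  `|x - x'| <= (r `^ d)^-1 * euclidean_dist (point t x) (point t x') `^ d.
Proof.
move=> x01 x01'.
have m0 : 0 < m%:R^-1 :> R by rewrite invr_gt0 ltr0n.
have [->|xx'] := eqVneq x x'.
  by rewrite subrr normr0 mulr_ge0// ?invr_ge0 ?powR_ge0.
pose P k := [exists i, point_digit t x i k != point_digit t x' i k].
have digE k i : point_digit t x i k = point_digit t x' i k ->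
    base_digit x (n * k + i) = base_digit x' (n * k + i).
  rewrite /point_digit => /addIn/eqP; rewrite eqn_mul2l/= => /eqP.
  by rewrite !(minn_idPr _) // -ltnS prednK// base_digit_lt.
have comm N : (forall k, (k < N)%N -> ~~ P k) -> `|x - x'| <= (r `^ d) ^+ N.
  move=> NP; rewrite r_dim -exprM; apply: common_digits_le => // j jN.
  have kN : (j %/ n < N)%N by rewrite ltn_divLR// mulnC.
  have := NP _ kN; rewrite negb_exists => /forallP/(_ (Ordinal (ltn_pmod j n_gt0))).
  by rewrite negbK => /eqP/digE/=; rewrite mulnC -divn_eq.
(* Were all digits equal, the bound [comm] would hold at every level and force [x = x']. *)
have exP : exists k, P k.
  apply: contrapT => nP.
  have rd1 : `|r `^ d| < 1.
    rewrite ger0_norm ?powR_ge0// r_dim exprn_ilt1 ?ltW//.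
    - by rewrite -lt0n.
    - by rewrite invf_lt1 ?ltr0n// ltr1n.
  have cvg0 := cvg_expr rd1.
  have : `|x - x'| <= limn (GRing.exp (r `^ d)).
    apply: limr_ge; first exact: cvgP cvg0.
    apply: nearW => N; apply: comm => k _; apply/negP => Pk; apply: nP.
    by exists k.
  by rewrite (cvg_lim _ cvg0)// normr_le0 subr_eq0 (negbTE xx').
have [N PN Nmin] := ex_minnP exP.
have NP k : (k < N)%N -> ~~ P k by move=> kN; apply/negP => /Nmin; rewrite leqNgt kN.
have /existsP[i iN] := PN.
have : r ^+ N.+1 <= euclidean_dist (point t x) (point t x').
  apply: le_trans (coord_le_euclidean_dist _ _ i).
  apply: first_digit_ge; rewrite ?digit_point//.
    move=> k /NP; rewrite !digit_point negb_exists => /forallP/(_ i).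
    by rewrite negbK => /eqP.
  by rewrite /point_digit !mul2n !oddD !odd_double.
move=> rN; apply: le_trans (comm _ NP) _.
rewrite ler_pdivlMl ?powR_gt0// -exprS.
rewrite -powR_mulrn ?powR_ge0// -powRrM [d * _]mulrC powRrM powR_mulrn ?(ltW
  r_gt0)//.
by apply: ge0_ler_powR; rewrite ?nnegrE ?exprn_ge0 ?sqrtr_ge0 ?(ltW d_gt0) ?(ltW
  r_gt0).
Qed.

Lemma cantor_set_ge t : (((2 * (r `^ d)^-1)^-1)%:E <= hausdorff d (cantor_set t))%E.
Proof.
have rd0 : 0 < (r `^ d)^-1 by rewrite invr_gt0 powR_gt0.
apply: le_trans (hausdorff_image_ge d_gt0 rd0 (point_dist t)) _.
by apply: le_hausdorff => _ [x _ <-]; exact: point_cantor.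
Qed.

End cantor_sets.

Lemma cantor_family (R : realType) (n : nat) (d : R) : (0 < n)%N -> 0 < d ->
  d < n%:R -> exists (C : (nat -> bool) -> set (borel_row R n)) (e : R),
  [/\ 0 < e, trivIset setT C, forall t, measurable (C t) &
      forall t, (e%:E <= borel_hausdorff d (C t) < +oo)%E].
Proof.
move=> n0 d0 dn.
pose p : R := n%:R / d - 1.
have p0 : 0 < p by rewrite subr_gt0 ltr_pdivlMr// mul1r.
pose m := (Num.truncn (2 `^ p^-1)).+2.
have m_gt : 2 `^ p^-1 < m%:R :> R.
  by apply: lt_le_trans (truncnS_gt _) _; rewrite ler_nat.
have mp : 2 < m%:R `^ p.
  have -> : 2 = (2 `^ p^-1) `^ p :> R by rewrite -powRrM mulVf ?gt_eqF// powRr1.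
  by apply: gt0_ltr_powR => //; rewrite nnegrE ?powR_ge0.
have m0 : 0 < m%:R :> R by rewrite ltr0n.
pose r : R := m%:R `^ (- (n%:R / d)).
have r0 : 0 < r by exact: powR_gt0.
have mr : (2 * m)%N%:R * r < 1.
  rewrite natrM -mulrA -[X in X * r](powRr1 (ltW m0)) -powRD; last first.
    by rewrite (gt_eqF m0) implybT.
  have -> : 1 - n%:R / d = - p by rewrite opprB.
  by rewrite powRN ltr_pdivrMr ?powR_gt0// mul1r.
have rd : r `^ d = m%:R^-1 ^+ n.
  by rewrite -powRrM mulNr divfK ?gt_eqF// powRN powR_mulrn ?ltW// exprVn.
exists (@cantor_set R n m r), ((2 * (r `^ d)^-1)^-1); split.
- by rewrite invr_gt0 mulr_gt0// invr_gt0 powR_gt0.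
- exact: trivIset_cantor_set.
- by move=> t; exact: measurable_cantor_set.
- move=> t; apply/andP; split; first exact: cantor_set_ge.
  exact: cantor_set_finite.
Qed.

(** * Coding sets of sigma-finite measure *)

Section hull.
Context (R : realType) (n : nat) (d : R).
Hypothesis d_gt0 : 0 < d.
Local Notation T := (borel_row R n).
Local Notation ball_index := ('rV[rat]_n * rat)%type.
Local Notation root_n := (Num.sqrt n%:R : R).

Lemma rational_ball_diameter (c : ball_index) (s : R) : 0 <= s -> ratr c.2 < 3 * s ->
  (diameter (@rational_ball R n c) <= (root_n * (6 * s))%:E)%E.
Proof.
move=> s0 cs; apply: diameter_le; first by rewrite mulr_ge0 ?sqrtr_ge0// mulr_ge0.
move=> x y cx cy; apply: euclidean_dist_le => [|i]; first by rewrite mulr_ge0.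
apply: le_trans (ler_distD (ratr (c.1 ord0 i)) _ _) _.
have := cx i; have := cy i; rewrite [`|y _ _ - _|]distrC.
move: (`|_ - _|) (`|_ - _|) => a b; lra.
Qed.

Lemma rational_ball_cover (A : set 'rV[R]_n) (s : R) : 0 < s ->
  (diameter A <= s%:E)%E ->
  exists c : ball_index, A `<=` @rational_ball R n c /\ ratr c.2 < 3 * s.
Proof.
move=> s0 As.
(* One [s] for the diameter of [A] and one for the distance from a point of [A] to a rational
   centre. *)
have [|q qs] := @rat_in_itvoo R (2 * s) (3 * s); first by rewrite ltr_pM2r// ltr_nat.
move: qs; rewrite in_itv/= => /andP[sq qs].
have [->|/set0P[z Az]] := eqVneq A set0.
  by exists (0, q); split=> // x [].
have [p pz] := rational_center z s0.
exists (p, q); split=> // x Ax i; apply: le_lt_trans (ler_distD (z ord0 i) _ _) _.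
have xz : `|x ord0 i - z ord0 i| <= s.
  apply: le_trans (coord_le_euclidean_dist _ _ i) _; rewrite -lee_fin.
  by apply: le_trans As; exact: dist_le_diameter.
by apply: lt_trans sq; have := pz i; move: xz;
  move: (`|_ - _|) (`|_ - _|) => a b; lra.
Qed.

(** The members of a cover that is optimal up to 1 are enlarged to rational cubes. A radius below
    [3 * s] gives sides below [6 * s], whence the factor [root_n * 6]. *)
Lemma hausdorff_delta_hull (e : R) (A : set 'rV[R]_n) :
  (hausdorff_delta d e A < +oo)%E -> 0 < e ->
  exists B : nat -> ball_index, A `<=` \bigcup_k @rational_ball R n (B k) /\
    (hausdorff_delta d (root_n * (6 * e)) (\bigcup_k @rational_ball R n (B k)) <=
     ((root_n * 6) `^ d)%:E * (hausdorff_delta d e A + 2%:E))%E.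
Proof.
move=> Afin e0.
have Af : hausdorff_delta d e A \is a fin_num.
  by rewrite ge0_fin_numE ?hausdorff_delta_ge0.
have [_ [U [AU Ue] <-] Uk] := lb_ereal_inf_adherent (@ltr01 R) Af.
(* Members of diameter 0 must also be put in a cube of positive size; [eta] is so small that this
   adds at most 1 in total, the second half of [2%:E]. *)
pose eta k : R := Num.min e ((1 / (2 ^ k.+1)%:R) `^ d^-1).
have eta0 k : 0 < eta k.
  by rewrite lt_min e0 powR_gt0// divr_gt0// ltr0n expn_gt0.
have etad k : eta k `^ d <= 1 / (2 ^ k.+1)%:R.
  have x0 : 0 <= 1 / (2 ^ k.+1)%:R :> R by rewrite divr_ge0 ?ler0n.
  rewrite -[leRHS](powRr1 x0) -[X in _ <= _ `^ X](mulVf (lt0r_neq0 d_gt0)) powRrM.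
  apply: ge0_ler_powR; rewrite ?nnegrE ?powR_ge0 ?(ltW d_gt0) ?(ltW (eta0 k))//.
  by rewrite ge_min lexx orbT.
have Ufin k : diameter (U k) \is a fin_num.
  by rewrite ge0_fin_numE ?diameter_ge0//; apply: le_lt_trans (Ue k) _; exact: ltry.
pose D k := fine (diameter (U k)).
have D0 k : 0 <= D k by rewrite fine_ge0// diameter_ge0.
have De k : D k <= e by rewrite -lee_fin fineK//; exact: Ue.
pose s k := Num.max (D k) (eta k).
have s0 k : 0 < s k by rewrite lt_max eta0 orbT.
have se k : s k <= e by rewrite ge_max De ge_min lexx.
have /choice[B BP] : forall k, exists c : ball_index,
    U k `<=` @rational_ball R n c /\ ratr c.2 < 3 * s k.
  move=> k; apply: rational_ball_cover => //.
  by rewrite -(fineK (Ufin k)) lee_fin le_max lexx.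
have Bd k : (diameter (@rational_ball R n (B k)) <= (root_n * (6 * s k))%:E)%E.
  by apply: rational_ball_diameter; [exact: ltW|exact: (BP k).2].
exists B; split.
  by apply: subset_trans AU _; apply: subset_bigcup => k _; exact: (BP k).1.
apply: (@le_trans _ _ (\sum_(k <oo) hausdorff_gauge d (@rational_ball R n (B k)))%E).
  apply: ereal_inf_lbound; exists (fun k => @rational_ball R n (B k)) => //.
  split=> // k; apply: le_trans (Bd k) _.
  by rewrite lee_fin ler_wpM2l ?sqrtr_ge0// ler_pM2l.
have c0 : (0 <= ((root_n * 6) `^ d)%:E)%E by rewrite lee_fin powR_ge0.
apply: (@le_trans _ _ (\sum_(k <oo) ((root_n * 6) `^ d)%:E *
   (hausdorff_gauge d (U k) + (1 / (2 ^ k.+1)%:R)%:E))%E).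
  apply: lee_nneseries => [k _ _|k _]; first exact: hausdorff_gauge_ge0.
  apply: le_trans (hausdorff_gauge_le d_gt0 (Bd k)) _.
  rewrite hausdorff_gaugeE// -(fineK (Ufin k)) poweR_EFin -EFinD -EFinM lee_fin.
  rewrite mulrA powRM ?mulr_ge0 ?sqrtr_ge0 ?(ltW (s0 k))// ler_wpM2l ?powR_ge0//.
  rewrite /s; case: (leP (D k) (eta k)) => _; last by rewrite lerDl divr_ge0 ?ler0n.
  by apply: le_trans (etad k) _; rewrite lerDr powR_ge0.
rewrite nneseriesZl; last first.
  by move=> k _; rewrite adde_ge0 ?hausdorff_gauge_ge0// lee_fin divr_ge0 ?ler0n.
rewrite lee_wpmul2l//.
apply: le_trans (epsilon_trick _ _ _) _ => //.
  by move=> k; exact: hausdorff_gauge_ge0.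
apply: le_trans (leeD2r _ (ltW Uk)) _.
by rewrite -addeA -EFinD.
Qed.

(** Intersecting the hulls over the scales [j.+1%:R^-1] bounds the content at every scale. The
    measure may grow by a constant factor, which is harmless since only finiteness is kept. *)
Lemma hausdorff_hull (A : set 'rV[R]_n) : (hausdorff d A < +oo)%E ->
  exists B : nat -> nat -> ball_index,
    A `<=` \bigcap_j \bigcup_k @rational_ball R n (B j k) /\
    (hausdorff d (\bigcap_j \bigcup_k @rational_ball R n (B j k)) < +oo)%E.
Proof.
move=> Afin.
have le_sup e (X : set 'rV[R]_n) : 0 < e -> (hausdorff_delta d e X <= hausdorff d
  X)%E.
  by move=> e0; apply: ereal_sup_ubound; exists e.
have e0 j : 0 < j.+1%:R^-1 :> R by rewrite invr_gt0.
have /choice[B BP] := fun j => hausdorff_delta_hull (le_lt_trans (le_sup _ A (e0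
  j)) Afin) (e0 j).
exists B; split; first by move=> x Ax j _; apply: (BP j).1.
apply: (@le_lt_trans _ _ (((root_n * 6) `^ d)%:E * (hausdorff d A + 2%:E))%E);
  last first.
  rewrite -(@fineK _ (hausdorff d A)) ?ge0_fin_numE ?hausdorff_ge0//.
  by rewrite -EFinD -EFinM ltry.
apply: ge_ereal_sup => _ [e /= e_gt0 <-].
pose c : R := root_n * 6.
have c0 : 0 <= c by rewrite mulr_ge0 ?sqrtr_ge0.
pose j := Num.truncn (c / e).
have je : root_n * (6 * j.+1%:R^-1) <= e.
  rewrite mulrA -/c ler_pdivrMr// -ler_pdivrMl// mulrC ltW//.
  exact: truncnS_gt.
apply: le_trans (hausdorff_delta_anti _ _ je) _.
apply: (@le_trans _ _ (hausdorff_delta d (root_n * (6 * j.+1%:R^-1))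
    (\bigcup_k @rational_ball R n (B j k)))).
  by apply: le_hausdorff_delta => x; exact.
apply: le_trans (BP j).2 _.
by rewrite lee_wpmul2l ?lee_fin ?powR_ge0// leeD2r// le_sup.
Qed.

(* Every set of sigma-finite measure lies in one of the sets [coded c], of which
   there are only continuum many. *)
Definition coded_piece (c : nat -> bool) (l : nat) : set T :=
  \bigcap_j \bigcup_(b in [set b : ball_index | c (@pickle (nat * nat *
    ball_index)%type (l, j, b))]) @rational_ball R n b.

Definition coded (c : nat -> bool) : set T := \bigcup_l coded_piece c l.

Lemma measurable_coded_piece c l : measurable (coded_piece c l).
Proof.
apply: bigcapT_measurable => j.
rewrite bigcup_mkcond; apply: countable_bigcupT_measurable => // b.
by case: ifP => // _; exact: measurable_rational_ball.
Qed.

Lemma sigma_finite_coded (A : set 'rV[R]_n) : hausdorff_sigma_finite d A ->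
  exists c, A `<=` coded c /\ forall l, (borel_hausdorff d (coded_piece c l) <
    +oo)%E.
Proof.
move=> [F AF Ffin].
have /choice[B BP] := fun l => hausdorff_hull (Ffin l).
pose c k := if @unpickle (nat * nat * ball_index)%type k is Some (l, j, b)
  then `[< exists k', B l j k' = b >] else false.
have cE l : coded_piece c l = \bigcap_j \bigcup_k @rational_ball R n (B l j k).
  apply: eq_bigcapr => j _; apply/seteqP; split=> x.
    move=> [b]; rewrite /= /c pickleK => /asboolP[k <-] bx; by exists k.
  by move=> [k _ bx]; exists (B l j k) => //=; rewrite /c pickleK; apply/asboolP;
    exists k.
exists c; split.
  by move=> x /AF[l _ Fx]; exists l => //; rewrite cE; apply: (BP l).1.
by move=> l; rewrite cE; exact: (BP l).2.
Qed.

End hull.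

(** * The continuum hypothesis and the partition *)

Local Notation bits := (nat -> bool).

Lemma uncountable_bits : ~ countable [set: bits].
Proof.
move=> /countable_injP[f fi].
pose D k := `[< exists2 b : bits, f b = k & ~~ b k >].
have : D (f D) = ~~ D (f D); last by case: (D (f D)).
apply/idP/idP => [/asboolP[b /fi e nb]|nD]; last by apply/asboolP; exists D.
by move: nb; rewrite e ?inE.
Qed.

Lemma bits_le_real (R : realType) : ([set: bits] #<= [set: R])%card.
Proof.
apply/pcard_injP; exists (fun b : bits => expansion (4^-1 : R) (fun k => b k : nat)).
move=> b b' _ _ /(@expansion_inj R 4^-1 1) e; apply/funext => k.
have r0 : 0 < 4^-1 :> R by rewrite invr_gt0.
have r1 : 2%:R * 4^-1 < 1 :> R by lra.
have le1 (c : bits) j : (c j <= 1)%N by case: (c j).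
by have := e r0 r1 (le1 b) (le1 b') => /(congr1 (fun a => a k)); case: (b k);
  case: (b' k).
Qed.

Lemma countable_enumeration (T : pointedType) (A : set T) : countable A ->
  A !=set0 ->
  exists s : nat -> T, range s = A.
Proof.
move=> /countable_injP[f fi] [a Aa].
pose s k := if pselect (exists2 x, A x & f x = k) is left h then projT1 (cid2 h)
  else a.
exists s; apply/seteqP; split=> [_ [k _ <-]|x Ax].
  by rewrite /s; case: pselect => // h; case: cid2.
exists (f x) => //; rewrite /s; case: pselect => [h|[]]; last by exists x.
by case: cid2 => y Ay /= /fi; apply; rewrite inE.
Qed.

(** Least elements of sets of one, two and three points give reflexivity, totality and, with
    antisymmetry, transitivity. On an uncountable [I] the order type is then omega_1. *)
Definition omega1_order (I : Type) (le : I -> I -> bool) : Prop :=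
  [/\ forall P : set I, P !=set0 -> exists2 z, P z & forall y, P y -> le z y,
      antisymmetric le & forall i, countable [set j | le j i]].

(** In any well-order having an uncountable initial segment, the strict predecessors [J] of the
    least such endpoint are uncountable with countable segments. Copied into the reals, [J] has the
    size of the continuum by CH, so the order can be pulled back along an injection of [bits] into
    [J]. *)
Lemma continuum_omega1_order (R : realType) : continuum_hypothesis R ->
  exists le : bits -> bits -> bool, omega1_order le.
Proof.
move=> CH; have [le le_wo] := well_ordering_principle bits.
have le_min (P : set bits) : P !=set0 -> exists2 z, P z & forall y, P y -> le z y.
  move=> [x Px]; have [|z [[zP zmin] _]] := le_wo (mem P).
    by exists x; rewrite inE.
  by exists z => [|y Py]; [rewrite inE in zP|apply: zmin; rewrite inE].
have le_anti : antisymmetric le.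
  move=> x y /andP[xy yx].
  have rr z : le z z.
    by have [_ -> //] := le_min [set z] (ex_intro _ z erefl); exact.
  have [|z [_ zuniq]] := le_wo (mem [set x; y]); first by exists x; rewrite inE;
    left.
  have <- : z = x.
    by apply: zuniq; split=> [|w]; rewrite !inE; [left|move=> [->|->]].
  by apply: zuniq; split=> [|w]; rewrite !inE; [right|move=> [->|->]].
have [ctbl|/existsNP[b nb]] := pselect (forall i, countable [set j | le j i]).
  by exists le; split.
have [a na amin] := le_min [set i | ~ countable [set j | le j i]] (ex_intro _ b nb).
pose J := [set j | le j a] `\` [set a].
have nJ : ~ countable J.
  move=> cJ; apply: na; pose K (b' : bool) := if b' then J else [set a].
  apply: (@sub_countable _ _ _ (\bigcup_b' K b')).
    apply: subset_card_le => j ja; have [->|ja'] := pselect (j = a).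
      by exists false.
    by exists true.
  by apply: bigcup_countable => [|[] _]; [exact: countableP|exact: cJ|exact:
    countable1].
have [h hJ hinj] : exists2 h : bits -> bits, forall i, J (h i) & injective h.
  have /pcard_injP[V Vi] := bits_le_real R.
  have VJ : (V @` J #= J)%card.
    by apply: inj_card_eq => x y _ _; apply: Vi; rewrite inE.
  have : ([set: bits] #<= J)%card.
    apply: card_le_trans (bits_le_real R) _.
    have [cVJ|RVJ] := CH (V @` J).
      by case: nJ; move: VJ; rewrite card_eq_le => /andP[_ /sub_countable]; exact.
    rewrite card_eq_sym in RVJ; move: (card_eq_trans RVJ VJ).
    by rewrite card_eq_le => /andP[].
  move=> /ppcard_leP[h]; exists h => [i|x y /(@inj _ _ _ h)]; first exact: funS.
  by apply; rewrite inE.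
exists (fun i j => le (h i) (h j)); split.
- move=> P [x Px]; have [|_ [z Pz <-] zmin] := le_min (h @` P).
    by exists (h x), x.
  by exists z => // y Py; apply: zmin; exists y.
- by move=> x y /le_anti/hinj.
- move=> i; have [ia nia] := hJ i.
  have ci : countable [set j | le j (h i)].
    apply: contrapT => nci; apply: nia; apply: le_anti.
    by rewrite ia amin.
  apply: (@sub_countable _ _ _ (h @` [set j | le (h j) (h i)])).
    by have : (h @` [set j | le (h j) (h i)] #= [set j | le (h j) (h i)])%card;
      [apply: inj_card_eq => x y _ _; exact: hinj|rewrite card_eq_le => /andP[]].
  by apply: sub_countable ci; apply: subset_card_le => _ [j ji <-].
Qed.

Section interleave.

(** Names one Cantor set by a triple: [i] is the piece that receives it, [k] its rank among the
    countably many added there, and [t] a parameter left free to avoid earlier sets. *)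
Definition interleave (t i : bits) (k : nat) : bits := fun j =>
  match @unpickle (nat + nat + nat)%type j with
  | Some (inl (inl a)) => t a
  | Some (inl (inr a)) => i a
  | Some (inr a) => a == k
  | None => false
  end.

Lemma interleave_inj t i k t' i' k' : interleave t i k = interleave t' i' k' ->
  [/\ t = t', i = i' & k = k'].
Proof.
move=> e; have E x := congr1 (fun f => f (@pickle (nat + nat + nat)%type x)) e.
split.
- by apply/funext => a; have := E (inl (inl a)); rewrite /interleave pickleK.
- by apply/funext => a; have := E (inl (inr a)); rewrite /interleave pickleK.
- by have := E (inr k); rewrite /interleave pickleK eqxx => /esym/eqP.
Qed.

End interleave.

Section partition.
Context (R : realType) (n : nat) (d : R) (le : bits -> bits -> bool).
Hypotheses (n_gt0 : (0 < n)%N) (d_gt0 : 0 < d) (d_lt : d < n%:R).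
Hypothesis le_omega1 : omega1_order le.
Local Notation T := (borel_row R n).
Local Notation mu := (@borel_hausdorff R n d).

Definition hausdorff_partition (X : bits -> set T) (Q : bits -> nat ->
  set T) : Prop :=
  [/\ trivIset setT X,
      forall i k, measurable (Q i k) /\ (mu (Q i k) < +oo)%E,
      forall i, X i = \bigcup_k Q i k,
      forall i, mu (X i) = +oo%E &
      forall S, hausdorff_sigma_finite d S -> exists s : nat -> bits,
        S `<=` \bigcup_k X (s k)].

Let seg_enum i : exists s : nat -> bits, range s = [set j | le j i].
Proof.
have [le_min _ ctbl] := le_omega1.
apply: countable_enumeration (ctbl i) _.
by have [_ -> ii] := le_min [set i] (ex_intro _ i erefl); exists i; exact: ii.
Qed.

(* Well-order all codes of sigma-finite sets in type omega_1. The [i]-th piece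
   is the part of the [i]-th coded set not yet covered, made infinite by adding
   countably many Cantor sets; of the uncountably many disjoint candidates for
   these, some choice meets the sigma-finite union of the earlier coded sets in
   a null set. *)
Lemma hausdorff_partition_exists : exists X Q, hausdorff_partition X Q.
Proof.
have [le_min le_anti _] := le_omega1.
have le_refl i : le i i.
  by have [_ -> ii] := le_min [set i] (ex_intro _ i erefl); exact: ii.
have [C [c [c0 tC mC Cc]]] := cantor_family n_gt0 d_gt0 d_lt.
have /choice[s sE] := seg_enum.
(* Codes with a piece of infinite measure are made to code the empty set. *)
pose P i l : set T := if `[< forall l, mu (coded_piece i l) < +oo >]%E
  then coded_piece i l else set0.
have mP i l : measurable (P i l).
  by rewrite /P; case: ifP => // _; exact: measurable_coded_piece.
have Pfin i l : (mu (P i l) < +oo)%E.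
  by rewrite /P; case: ifPn => [/asboolP|_]; [exact|rewrite measure0].
pose D t i := \bigcup_k C (interleave t i k).
have mD t i : measurable (D t i) by apply: bigcupT_measurable => k; exact: mC.
have DD t i t' i' x : D t i x -> D t' i' x -> t = t' /\ i = i'.
  move=> [k _ Cx] [k' _ Cx'].
  have := tC (interleave t i k) (interleave t' i' k') Logic.I Logic.I.
  by move=> /(_ (ex_intro _ x (conj Cx Cx')))/interleave_inj[].
have Doo t i : mu (D t i) = +oo%E.
  apply: (measure_bigcup_infinite c0) => [k|k k' _ _|k].
  - exact: mC.
  - by move=> /(tC _ _ Logic.I Logic.I)/interleave_inj[].
  - by have /andP[] := Cc (interleave t i k).
(* All finite-measure coded pieces with index up to [i], in one sequence; [s i] enumerates the
   indices below [i], and [i] itself. *)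
pose F i k := if @unpickle (nat * nat)%type k is Some (a,
  l) then P (s i a) l else set0.
have /choice[t tP] : forall i, exists t, forall k, mu (D t i `&` F i k) = 0%E.
  move=> i; apply: exists_null_member.
  - exact: uncountable_bits.
  - by move=> t; exact: mD.
  - by move=> t t' _ _ [x [Dx Dx']]; have [] := DD _ _ _ _ _ Dx Dx'.
  - by move=> k; rewrite /F; case: unpickle => [[a l]|];
    [exact: mP|exact: measurable0].
  - by move=> k; rewrite /F; case: unpickle => [[a l]|];
    [exact: Pfin|rewrite measure0].
pose Q' i k := P i k `|` C (interleave (t i) i k).
have mQ' i k : measurable (Q' i k) by exact: measurableU.
have Q'fin i k : (mu (Q' i k) < +oo)%E.
  apply: le_lt_trans (measureU2 _ _ _) _ => //.
  apply: lte_add_pinfty; first exact: Pfin.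
  by have /andP[] := Cc (interleave (t i) i k).
pose A i := \bigcup_k Q' i k.
have mA i : measurable (A i) by exact: bigcupT_measurable.
pose B i := \bigcup_k (if `[< s i k = i >] then set0 else A (s i k)).
have mB i : measurable (B i).
  by apply: bigcupT_measurable => k; case: ifP.
have BE i x : B i x <-> exists j, [/\ le j i, j <> i & A j x].
  split=> [[k _]|[j [ji ij Ax]]].
    case: asboolP => // si Ax; exists (s i k); split=> //.
    have : range (s i) (s i k) by exists k.
    by rewrite sE.
  have : range (s i) j by rewrite sE.
  by move=> [k _ skj]; exists k => //; case: asboolP; rewrite skj.
pose X i := A i `\` B i.
have mX i : measurable (X i) by exact: measurableD.
exists X, (fun i k => Q' i k `&` X i); split.
- move=> i j _ _ [x [[Aix nBi] [Ajx nBj]]].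
  have [z zij zmin] := le_min [set i; j] (ex_intro _ i (or_introl erefl)).
  have zi := zmin i (or_introl erefl); have zj := zmin j (or_intror erefl).
  case: zij => /= ze; rewrite ze in zi zj.
    apply: contrapT => ij; apply: nBj; apply/BE; exists i; split=> //.
  by apply: contrapT => ij; apply: nBi; apply/BE; exists j; split=> // /esym.
- move=> i k; split; first exact: measurableI.
  apply: le_lt_trans (Q'fin i k); apply: le_measure; rewrite ?inE//.
  exact: measurableI.
- by move=> i; rewrite -setI_bigcupl; apply/esym/setIidr => x [].
- move=> i.
  have Fnull : mu (\bigcup_k (D (t i) i `&` F i k)) = 0%E.
    apply: measure_bigcup_null => k; last exact: tP.
    apply: measurableI; first exact: mD.
    by rewrite /F; case: unpickle => [[a l]|]; [exact: mP|exact: measurable0].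
  have : (mu (D (t i) i) <= mu (X i) + mu (\bigcup_k (D (t i) i `&` F i k)))%E.
    have mDF : measurable (\bigcup_k (D (t i) i `&` F i k)).
      apply: bigcupT_measurable => k; apply: measurableI; first exact: mD.
      by rewrite /F; case: unpickle => [[a l]|]; [exact: mP|exact: measurable0].
    apply: le_trans (measureU2 _ _ _) => //; apply: le_measure; rewrite ?inE//.
      exact: measurableU.
    move=> x Dx; have [|nBx] := pselect (B i x); last first.
      by left; split=> //; have [k _ Ck] := Dx; exists k => //; right.
    (* A point lost to an earlier [A j] lies either in a Cantor set added to [j], excluded by
       disjointness, or in a coded piece, where [t i] was chosen to make the loss null. *)
    move=> /BE[j [ji nji [k _ [Pjk|Cjk]]]]; last first.
      have Djx : D (t j) j x by exists k.
      by case: nji; have [_ ->] := DD _ _ _ _ _ Dx Djx.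
    have [a _ sa] : range (s i) j by rewrite sE.
    right; exists (pickle (a, k)); first exact: Logic.I.
    by split=> //; rewrite /F pickleK sa.
  by rewrite [X in (_ + X)%E]Fnull adde0 Doo leye_eq => /eqP.
- move=> S /(sigma_finite_coded d_gt0)[b [Sb bfin]]; exists (s b) => x Sx.
  have Abx : A b x.
    have [l _ bx] := Sb _ Sx; exists l => //; left.
    by rewrite /P ifT//; apply/asboolP.
  (* The point belongs to the piece of the least index whose [A] contains it, and that index is
     among the countably many predecessors of [b]. *)
  have [z Azx zmin] := le_min [set j | A j x] (ex_intro _ b Abx).
  have [k _ sk] : range (s b) z by rewrite sE; exact: zmin.
  exists k => //; rewrite sk; split=> // /BE[j [jz nj Ajx]].
  by apply: nj; apply: le_anti; rewrite jz zmin.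
Qed.

End partition.

(** * Gluing the isomorphisms of the pieces *)

Section gluing.
Context (R : realType) (n : nat) (d1 d2 : R).
Local Notation T := (borel_row R n).
Local Notation mu1 := (@borel_hausdorff R n d1).
Local Notation mu2 := (@borel_hausdorff R n d2).
Variables (X : bits -> set T) (Q : bits -> nat -> set T).
Variables (Y : bits -> set T) (P : bits -> nat -> set T).
Hypotheses (partX : hausdorff_partition d1 X Q).
Hypotheses (partY : hausdorff_partition d2 Y P).

(** Countably many pieces cover the complement, so [S] contains one of the remaining pieces
    entirely, and that piece has infinite measure. *)
Lemma partition_sub_cofinite S :
  hausdorff_sigma_finite d1 (~` S) -> mu1 S = +oo%E.
Proof.
have [tX mQ XE Xoo cov] := partX.
have mX i : measurable (X i) by rewrite XE; apply: bigcupT_measurable => k;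
  case: (mQ i k).
move=> /cov[s Ss].
have [i ni] : exists i, ~ range s i.
  apply: contrapT => /forallNP all_s; apply: uncountable_bits.
  apply: (@sub_countable _ _ _ (range s)).
    by apply: subset_card_le => i _; apply: contrapT; exact: all_s.
  by apply: card_le_trans (card_image_le s setT) _; exact: countableP.
apply/eqP; rewrite eq_le leey/= -(Xoo i); apply: le_hausdorff => x Xix.
apply: contrapT => /Ss[k _ Xsx]; apply: ni; exists k => //.
by apply: tX => //; exists x.
Qed.

Lemma glue_measurable (f : T -> T) : injective f ->
  (forall i, measure_iso mu1 mu2 (X i) (Y i) f) ->
  forall S, borel_sigma_finite d1 S -> hausdorff_sigma_finite d1 S ->
  [/\ borel_sigma_finite d2 (f @` S), hausdorff_sigma_finite d2 (f @` S) &
      hausdorff d2 (f @` S) = hausdorff d1 S].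
Proof.
move=> fi fX S [mS _] sS.
have [tX mQ XE Xoo cov] := partX; have [_ mP YE _ _] := partY.
have mX i : measurable (X i) by rewrite XE; apply: bigcupT_measurable => k;
  case: (mQ i k).
have {mS}mS : measurable (S : set T) by [].
have [s Ss] := cov _ sS.
(* The enumeration [s] may repeat an index, so the parts are made disjoint before measures are
   added. *)
pose B : nat -> set T := seqDU (fun k => S `&` X (s k)).
have mB k : measurable (B k).
  by apply: measurableD; [exact: measurableI|apply: bigsetU_measurable => j _;
    exact: measurableI].
have BX k : B k `<=` X (s k) by move=> x [[]].
have SE : S = \bigcup_k B k.
  by rewrite -seqDU_bigcup_eq -setI_bigcupr; apply/esym/setIidl.
have mfB k : measurable (f @` B k) by have [[[_ _ im _] _] _] := fX (s k); exact: im.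
have fBE k : mu2 (f @` B k) = mu1 (B k) by have [[_ e] _] := fX (s k); exact: e.
have fSE : f @` S = \bigcup_k (f @` B k) by rewrite SE image_bigcup.
have tB : trivIset setT B := trivIset_seqDU _.
have tfB : trivIset setT (fun k => f @` B k).
  move=> i j _ _ [_ [[x Bx <-] [y By /fi e]]]; apply: tB => //.
  by exists x; split=> //; rewrite -e.
have sfS : hausdorff_sigma_finite d2 (f @` S).
  apply: (@sub_hausdorff_sigma_finite _ _ _ _ (\bigcup_k Y (s k))).
    move=> _ [x Sx <-]; have [k _ Xx] := Ss _ Sx; exists k => //.
    by have [_ <-] := fX (s k); exists x.
  apply: hausdorff_sigma_finite_bigcup => k; rewrite YE.
  by exists (P (s k)) => // l; have [] := mP (s k) l.
split=> //.
  split; last by left.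
  by rewrite fSE; apply: (@bigcupT_measurable _ T).
have -> : hausdorff d2 (f @` S) = mu2 (\bigcup_k (f @` B k)) by rewrite -fSE.
have -> : hausdorff d1 S = mu1 (\bigcup_k B k) by rewrite -SE.
rewrite (measure_semi_bigcup _ mfB tfB (bigcupT_measurable _ mfB)).
rewrite (measure_semi_bigcup _ mB tB (bigcupT_measurable _ mB)).
by apply: eq_eseriesr => k _; exact: fBE.
Qed.

End gluing.

(** A sigma-finite set is treated piecewise. For a co-sigma-finite one, bijectivity passes to the
    complement, and both measures are infinite. *)
Lemma glue_image (R : realType) (n : nat) (d1 d2 : R) X Q Y P
    (f : borel_row R n -> borel_row R n) : bijective f ->
  hausdorff_partition d1 X Q -> hausdorff_partition d2 Y P ->
  (forall i, measure_iso (@borel_hausdorff R n d1) (@borel_hausdorff R n d2)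
     (X i) (Y i) f) ->
  forall S, borel_sigma_finite d1 S ->
  borel_sigma_finite d2 (f @` S) /\ hausdorff d2 (f @` S) = hausdorff d1 S.
Proof.
move=> fbij partX partY fX S bS.
have fi := bij_inj fbij.
have [mS [sS|sCS]] := bS; first by have [] := glue_measurable partX partY fi fX
  bS sS.
have [mfS sfS _] := glue_measurable partX partY fi fX (borel_sigma_finiteC bS) sCS.
have fSE : f @` S = ~` (f @` (~` S)).
  have [g fK gK] := fbij.
  apply/seteqP; split=> [_ [x Sx <-] [y nSy /fi e]|y nSy]; first by apply: nSy;
    rewrite e.
  exists (g y); last exact: gK.
  by apply: contrapT => nS; apply: nSy; exists (g y).
split; first by rewrite fSE; exact: borel_sigma_finiteC.
rewrite [RHS](partition_sub_cofinite partX sCS).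
by apply: (partition_sub_cofinite partY); rewrite fSE setCK.
Qed.

Theorem theorem2p3 (R : realType) (hCH : continuum_hypothesis R)
    (n : nat) (hn : (0 < n)%N) (d1 d2 : R)
    (hd1 : 0 < d1) (hd12 : d1 <= d2) (hd2 : d2 < n%:R) :
  measure_isomorphic (hausdorff_measure n d1) (hausdorff_measure n d2).
Proof.
have [le le_omega1] := continuum_omega1_order hCH.
have [X [Q partX]] := hausdorff_partition_exists hn hd1 (le_lt_trans hd12 hd2)
  le_omega1.
have [Y [P partY]] := hausdorff_partition_exists hn (lt_le_trans hd1 hd12) hd2
  le_omega1.
have standard d X' Q' : 0 < d -> hausdorff_partition d X' Q' ->
    forall i, exists f, measure_iso (@borel_hausdorff R n d) (@half_lebesgue R)
      (X' i) setT f.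
  move=> d0 [_ mQ XE Xoo _] i; rewrite XE; apply: standard_iso.
  - by move=> x; exact: hausdorff_point.
  - by move=> k; have [] := mQ i k.
  - by move=> k; have [] := mQ i k.
  - by rewrite -XE; exact: Xoo.
have [tX mQ XE _ covX] := partX; have [tY mP YE _ covY] := partY.
have mX i : measurable (X i) by rewrite XE; apply: bigcupT_measurable => k;
  case: (mQ i k).
have mY i : measurable (Y i) by rewrite YE; apply: bigcupT_measurable => k;
  case: (mP i k).
(* The pieces cover the whole space because they cover every sigma-finite set, in particular every
   point. *)
have point_sigma_finite d x : 0 < d -> hausdorff_sigma_finite d [set x : 'rV[R]_n].
  move=> d0; exists (fun=> [set x]); first by move=> y yx; exists 0%N.
  by move=> k; rewrite hausdorff_point.
have /choice[ix ixP] : forall x, exists i, X i x.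
  move=> x; have [s /(_ x erefl)[k _ Xx]] := covX _ (point_sigma_finite _ x hd1).
  by exists (s k).
have /choice[iy iyP] : forall y, exists i, Y i y.
  move=> y; have [s /(_ y erefl)[k _ Yy]] := covY _ (point_sigma_finite _ y
    (lt_le_trans hd1 hd12)).
  by exists (s k).
have iXE i x : X i x -> ix x = i by move=> Xx; apply: tX => //; exists x.
have iYE i y : Y i y -> iy y = i by move=> Yy; apply: tY => //; exists y.
have /choice[h hP] : forall i, exists h, measure_iso (@borel_hausdorff R n d1)
    (@borel_hausdorff R n d2) (X i) (Y i) h.
  move=> i; have [f1 e1] := standard _ _ _ hd1 partX i.
  have [f2 e2] := standard _ _ _ (lt_le_trans hd1 hd12) partY i.
  have [g2 e3 _] := measure_iso_inverse (mY i) e2.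
  by exists (g2 \o f1); exact: measure_iso_comp e1 e3.
have /choice[g gP] : forall i, exists g, measure_iso (@borel_hausdorff R n d2)
    (@borel_hausdorff R n d1) (Y i) (X i) g /\ {in X i, cancel (h i) g}.
  by move=> i; have [g ? ?] := measure_iso_inverse (mX i) (hP i); exists g.
pose F x := h (ix x) x; pose G y := g (iy y) y.
have FX i x : X i x -> F x = h i x by move=> /iXE; rewrite /F => ->.
have GY i y : Y i y -> G y = g i y by move=> /iYE; rewrite /G => ->.
have hY i x : X i x -> Y i (h i x) by move=> Xx; have [_ <-] := hP i; exists x.
have FK : cancel F G.
  move=> x; rewrite /F (GY _ _ (hY _ _ (ixP x))).
  by have [_ ->//] := gP (ix x); rewrite inE.
have GK : cancel G F.
  move=> y; have [_ hXY] := hP (iy y); have := iyP y.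
  by rewrite -{1}hXY => -[x Xx <-]; rewrite -(FX _ _ Xx) FK.
have Fiso i : measure_iso (@borel_hausdorff R n d1) (@borel_hausdorff R n d2) (X
  i) (Y i) F.
  by apply: eq_measure_iso (hP i) => x /FX.
have Giso i : measure_iso (@borel_hausdorff R n d2) (@borel_hausdorff R n d1) (Y
  i) (X i) G.
  by apply: eq_measure_iso (gP i).1 => y /GY.
have Fbij : bijective F by exists G.
have Gbij : bijective G by exists F.
exists F; split; [exact: Fbij|move=> S mS|move=> S mS];
  first exact: (glue_image Fbij partX partY Fiso mS).
(* Preimages under [F] are images under [G], so the second half is the first with the two partitions
   exchanged. *)
have GE : F @^-1` S = G @` S.
  apply/seteqP; split=> [x Sx|_ [y Sy <-]]; first by exists (F x).
  by rewrite /= GK.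
by rewrite GE; exact: (glue_image Gbij partY partX Giso mS).
Qed.
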